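(* Let $L\in C^1(\mathbb{R}^n)$ be bounded below, $c\in\mathbb{R}$ with $\inf_{\mathbb{R}^n}(L+c)>0$, $l=\sqrt{L+c}$. Let $\Theta=\{\theta\in\mathbb{R}^n: B\theta=b\}$ with $B\in\mathbb{R}^{m\times n}$, $b\in\mathbb{R}^m$, and put $L^*=\inf_\Theta L$, $l^*=\sqrt{L^*+c}$. For $\theta\in\Theta$ let $G(\theta)\in\mathbb{R}^{n\times n}$ be symmetric positive definite with all eigenvalues in $[\lambda_1,\lambda_n]$, where $0<\lambda_1\le\lambda_n$ do not depend on $\theta$, and let $P(\theta)$ be the $G(\theta)$-orthogonal projection of $\mathbb{R}^n$ onto $\ker(B)$. Let $\theta_0\in\Theta$, $r_0>0$, $\eta>0$, and let $(\theta_k,r_k)$ be generated by $$v_k=P(\theta_k)G(\theta_k)^{-1}\nabla l(\theta_k),\qquad r_{k+1}=\frac{r_k}{1+2\eta\|v_k\|^2},\qquad \theta_{k+1}=\theta_k-2\eta r_{k+1}v_k .$$ Write $P_k=P(\theta_k)$, and $$\eta_0:=\frac{\lambda_1l^*}{\alpha r_0},\qquad \eta_s:=\frac{4l^*\lambda_1}{\alpha r_0^2}\left(r_0-\frac{l(\theta_0)-l^*}{\lambda_1}\right)$$ (used when $L$ is $\alpha$-smooth with $\alpha>0$). Then: (1) (Unconditional energy stability) For any $\eta>0$ and all $k\ge 0$, $r_{k+1}^2=r_k^2-(r_{k+1}-r_k)^2-\frac1\eta\|\theta_{k+1}-\theta_k\|^2$. This implies that $r_k$ is strictly decreasing and converges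 to some $r^*$ as $k\to\infty$. Furthermore $\sum_{k=0}^\infty\|\theta_{k+1}-\theta_k\|^2\le\eta r_0^2$, so that $\lim_{k\to\infty}\|\theta_{k+1}-\theta_k\|=0$. (2) (Positive lower bound) If $L$ is $\alpha$-smooth, $r_0\ge\frac{l(\theta_0)-l^*}{\lambda_1}$ and $\eta<\eta_s$, then $r_k\ge r^*>0$ for all $k$. (3) (Monotonic convergence) If $L$ is $\alpha$-smooth, $r_0\ge\frac{l(\theta_0)-l^*}{\lambda_1}$ and $0<\eta\le\min\{\eta_0,\eta_s\}$, then $L(\theta_k)$ decreases monotonically and converges towards a local minimum value of $L$, with $$\lim_{k\to\infty}\|P_k^\top\nabla L(\theta_k)\|=0 .$$ (4) (Convergence rates) (i) For any $\eta>0$ and $r_0>0$, for all $k\ge1$, $$\min_{j<k}\|P_j^\top\nabla L(\theta_j)\|^2\le\frac{2r_0\lambda_n^2}{\eta r_kk}\Big(\max_{j<k}L(\theta_j)+c\Big).$$ Now suppose $L$ is $\alpha$-smooth, $r_0\ge\frac{l(\theta_0)-l^*}{\lambda_1}$ and $0<\eta\le\min\{\eta_0,\eta_s\}$; then $r_k> r^*>0$, and the following rates hold: (ii) If $L$ satisfies the projected PL (Polyak–Lojasiewicz) condition with a minimizer $\theta^*\in\Theta$ of $L$ over $\Theta$, i.e. for some $\mu>0$ $$\tfrac12\|P(\theta)^\top\nabla L(\theta)\|^2\ge\mu\big(L(\theta)-L(\theta^* )\big)\quad\forall\theta\in\Theta,$$ then $(\theta_k)$ has finite length, $\sum_{k}\|\theta_{k+1}-\theta_k\|<\infty$,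 and hence converges; furthermore, $$L(\theta_k)-L(\theta^* )\le e^{-c_0kr_k/\lambda_n}\big(L(\theta_0)-L(\theta^* )\big),\qquad c_0:=\frac{\mu\eta}{l(\theta_0)} .$$ (iii) If $L$ is convex with a minimizer $\theta^*\in\Theta$ of $L$ over $\Theta$, then $$L(\theta_k)-L(\theta^* )\le\frac{c_1\lambda_n\|\theta_0-\theta^*\|^2}{kr_k},\qquad c_1=\frac{2l(\theta_0)}{\eta}.$$
   Context: $\|\cdot\|$ is the Euclidean norm for vectors and the spectral norm for matrices. $L$ is $\alpha$-smooth if $\|\nabla^2L(\theta)\|\le\alpha$ for all $\theta\in\mathbb{R}^n$. The $G(\theta)$-orthogonal projection is the orthogonal projection with respect to the inner product $\langle v_1,v_2\rangle_{G(\theta)}=v_1^\top G(\theta)v_2$; explicitly (when $BG(\theta)^{-1}B^\top$ is invertible), $P(\theta)=I-G(\theta)^{-1}B^\top(BG(\theta)^{-1}B^\top)^{-1}B$. Since $v_k\in\ker(B)$, all iterates $\theta_k$ remain in $\Theta$.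
   Formalization: Strict decrease of r_k and r_k>r* are claimed only when v_k≠0; in (3) accumulation points are stationary with the limit value, a local minimum value if all stationary points are local minimizers; (iii) has max_{j<k}‖θ_j−θ*‖² in place of ‖θ_0−θ*‖², the original bound only for constant G. *)

(* Defs.v *)
From mathcomp Require Export all_boot all_order all_algebra.
From mathcomp Require Export all_classical all_reals all_analysis.

Set Implicit Arguments.
Unset Strict Implicit.
Unset Printing Implicit Defensive.

Export Order.TTheory GRing.Theory Num.Theory.
Export numFieldNormedType.Exports.

Local Open Scope classical_set_scope.
Local Open Scope ring_scope.

(* The library norm on matrices is the sup norm, which induces the usual      *)
(* topology but is not the norm of the estimates; hence [enorm].              *)
Definition enorm (R : realType) (n : nat) (x : 'cV[R]_n) : R :=
  Num.sqrt (\sum_(i < n) x i 0 ^+ 2).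

Definition spectral_norm (R : realType) (m n : nat) (A : 'M[R]_(m, n)) : R :=
  sup [set enorm (A *m x) | x in [set x : 'cV[R]_n | enorm x <= 1]].

Definition grad (R : realType) (n : nat) (f : 'cV[R]_n -> R) (x : 'cV[R]_n)
  : 'cV[R]_n :=
  \col_(i < n) 'D_(delta_mx i 0) f x.

Definition hess (R : realType) (n : nat) (f : 'cV[R]_n -> R) (x : 'cV[R]_n)
  : 'M[R]_n :=
  \matrix_(i < n, j < n) 'D_(delta_mx j 0) (fun y => grad f y i 0) x.

Definition class_C1 (R : realType) (n : nat) (f : 'cV[R]_n -> R) : Prop :=
  (forall x, differentiable f x) /\ continuous (grad f).

(* [derive] is total, so the existence of the Hessian is required separately. *)
Definition smooth (R : realType) (n : nat) (alpha : R) (f : 'cV[R]_n -> R)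
  : Prop :=
  (forall x, differentiable (grad f) x) /\
  (forall x, spectral_norm (hess f x) <= alpha).

Definition inner (R : realType) (n : nat) (G : 'M[R]_n) (x y : 'cV[R]_n) : R :=
  (x^T *m G *m y) 0 0.

Definition sym_posdef (R : realType) (n : nat) (G : 'M[R]_n) : Prop :=
  G^T = G /\ (forall x : 'cV[R]_n, x != 0 -> 0 < inner G x x).

(* No rank assumption on B; when B *m invmx G *m B^T is invertible the only   *)
(* such P is 1%:M - invmx G *m B^T *m invmx (B *m invmx G *m B^T) *m B.       *)
Definition orth_proj_ker (R : realType) (m n : nat) (G : 'M[R]_n)
    (B : 'M[R]_(m, n)) (P : 'M[R]_n) : Prop :=
  (forall x : 'cV[R]_n, B *m (P *m x) = 0) /\
  (forall x y : 'cV[R]_n, B *m y = 0 -> inner G (x - P *m x) y = 0).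

Definition affine_set (R : realType) (m n : nat) (B : 'M[R]_(m, n))
    (b : 'cV[R]_m) : set 'cV[R]_n :=
  [set x | B *m x = b].

Definition sqrt_shift (R : realType) (n : nat) (L : 'cV[R]_n -> R) (c : R)
    (x : 'cV[R]_n) : R :=
  Num.sqrt (L x + c).

Definition sqrt_shift_inf (R : realType) (n : nat) (L : 'cV[R]_n -> R) (c : R)
    (Theta : set 'cV[R]_n) : R :=
  Num.sqrt (inf (L @` Theta) + c).

Definition minimizer_on (R : realType) (n : nat) (Theta : set 'cV[R]_n)
    (L : 'cV[R]_n -> R) (x : 'cV[R]_n) : Prop :=
  Theta x /\ (forall y, Theta y -> L x <= L y).

Definition local_minimizer_on (R : realType) (n : nat) (Theta : set 'cV[R]_n)
    (L : 'cV[R]_n -> R) (x : 'cV[R]_n) : Prop :=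
  Theta x /\ (\forall y \near x, Theta y -> L x <= L y).

(* Below, [lstar] is l^* and [l0] is l(theta_0).                              *)
Definition eta_zero (R : realType) (alpha lam1 lstar r0 : R) : R :=
  lam1 * lstar / (alpha * r0).

Definition eta_stab (R : realType) (alpha lam1 lstar l0 r0 : R) : R :=
  4 * lstar * lam1 / (alpha * r0 ^+ 2) * (r0 - (l0 - lstar) / lam1).

(* Main.v *)
(* With g = grad l, the step v = P G^-1 g satisfies G v = P^T g and B v = 0, *)
(* so v^T G v = g^T v lies between lam1 |v|^2 and lamn |v|^2. The r-update is *)
(* r_k - r_{k+1} = 2 eta r_{k+1} |v_k|^2, which gives the energy identity;   *)
(* its sum is the unconditional rate. For smooth L the descent lemma         *)
(* combined with the concavity of the square root yields                     *)
(* l_{k+1} - l_k <= lam1 (r_{k+1} - r_k) + alpha |theta_{k+1} - theta_k|^2 / *)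
(* (4 lstar), whose sum bounds r_k from below; for eta <= eta_zero it also   *)
(* yields L_{k+1} <= L_k - 2 eta r_{k+1} l_k v_k^T G v_k, and the bound      *)
(* |P^T grad L|^2 <= 4 l_k^2 lamn v_k^T G v_k turns this into the            *)
(* Polyak-Lojasiewicz and convex rates.                                      *)
From HB Require Import structures.
Require Import Defs.
From mathcomp Require Import ring lra.

Set Implicit Arguments.
Unset Strict Implicit.
Unset Printing Implicit Defensive.

Local Open Scope classical_set_scope.
Local Open Scope ring_scope.

(** Written as r_k - r_{k+1} = 2 eta r_{k+1} |v_k|^2 ([r_decrement]), the update makes r a
    bookkeeping variable: squared step lengths are differences of r up to known factors, so their
    sums telescope for every eta. This gives [energy_identity] and, through P^T grad L = 2 l G v
    ([Pgrad_Gv]), the unconditional bound [min_Pgrad_rate].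

    These bounds lose their force if r_k tends to 0. For smooth L, [l_descent] ties the decrease of
    l to that of r, up to quadratic errors whose sum is at most alpha eta r_0^2 / (4 lstar). Since l
    stays above lstar, r cannot be exhausted when eta <= eta_stab ([r_lower_bound], [rlim_gt0]).

    When eta <= eta_zero, the quadratic error consumes at most half of the first-order decrease, so
    L itself descends ([L_decrease], [L_decrease_Pgrad]). With both bounds on eta, steps tending to
    zero force the projected gradient to zero ([Pgrad_cvg0]), and continuity of grad L carries this
    to cluster points. The rates then follow as for gradient descent: contraction of the gap under
    the PL condition ([PL_rate]), the recursion of [sublinear_rate] for convex L, and a telescoping
    G-distance when the metric is constant. Monotonicity of r lets r_k stand in for every earlier
    r_{j+1} in these rates. *)

(** * Inner products, the Euclidean norm and spectral bounds *)

Section InnerProducts.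
Context {R : realType}.

Definition dot (n : nat) (x y : 'cV[R]_n) : R := inner 1%:M x y.

Lemma innerDl (n : nat) (G : 'M[R]_n) (x y z : 'cV[R]_n) :
  inner G (x + y) z = inner G x z + inner G y z.
Proof. by rewrite /inner linearD !mulmxDl mxE. Qed.

Lemma innerDr (n : nat) (G : 'M[R]_n) (x y z : 'cV[R]_n) :
  inner G x (y + z) = inner G x y + inner G x z.
Proof. by rewrite /inner mulmxDr mxE. Qed.

Lemma innerZl (n : nat) (G : 'M[R]_n) (a : R) (x y : 'cV[R]_n) :
  inner G (a *: x) y = a * inner G x y.
Proof. by rewrite /inner linearZ /= -!scalemxAl mxE. Qed.

Lemma innerZr (n : nat) (G : 'M[R]_n) (a : R) (x y : 'cV[R]_n) :
  inner G x (a *: y) = a * inner G x y.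
Proof. by rewrite /inner -scalemxAr mxE. Qed.

Lemma innerNl (n : nat) (G : 'M[R]_n) (x y : 'cV[R]_n) :
  inner G (- x) y = - inner G x y.
Proof. by rewrite -scaleN1r innerZl mulN1r. Qed.

Lemma innerNr (n : nat) (G : 'M[R]_n) (x y : 'cV[R]_n) :
  inner G x (- y) = - inner G x y.
Proof. by rewrite -scaleN1r innerZr mulN1r. Qed.

Lemma innerC (n : nat) (G : 'M[R]_n) (x y : 'cV[R]_n) :
  G^T = G -> inner G x y = inner G y x.
Proof.
move=> symG; rewrite /inner.
have -> : x^T *m G *m y = (y^T *m G *m x)^T.
  by rewrite !trmx_mul trmxK symG mulmxA.
by rewrite mxE.
Qed.

Lemma inner0l (n : nat) (G : 'M[R]_n) (y : 'cV[R]_n) : inner G 0 y = 0.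
Proof. by rewrite -(scale0r 0) innerZl mul0r. Qed.

Lemma inner_dot (n : nat) (G : 'M[R]_n) (x y : 'cV[R]_n) :
  inner G x y = dot x (G *m y).
Proof. by rewrite /dot /inner mulmx1 mulmxA. Qed.

Lemma dot_trmx (n : nat) (A : 'M[R]_n) (x y : 'cV[R]_n) :
  dot (A^T *m x) y = dot x (A *m y).
Proof. by rewrite /dot /inner !mulmx1 trmx_mul trmxK mulmxA. Qed.

Lemma dotC (n : nat) (x y : 'cV[R]_n) : dot x y = dot y x.
Proof. by apply: innerC; rewrite trmx1. Qed.

Lemma dotE (n : nat) (x y : 'cV[R]_n) : dot x y = \sum_i x i 0 * y i 0.
Proof.
by rewrite /dot /inner mulmx1 mxE; apply: eq_bigr => i _; rewrite mxE.
Qed.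

Lemma dot_xx_ge0 (n : nat) (x : 'cV[R]_n) : 0 <= dot x x.
Proof. by rewrite dotE; apply: sumr_ge0 => i _; rewrite -expr2 sqr_ge0. Qed.

Lemma enormE (n : nat) (x : 'cV[R]_n) : enorm x = Num.sqrt (dot x x).
Proof.
by rewrite /enorm dotE; congr Num.sqrt; apply: eq_bigr => i _; rewrite expr2.
Qed.

Lemma enorm_sqr (n : nat) (x : 'cV[R]_n) : enorm x ^+ 2 = dot x x.
Proof. by rewrite enormE sqr_sqrtr // dot_xx_ge0. Qed.

Lemma enorm_ge0 (n : nat) (x : 'cV[R]_n) : 0 <= enorm x.
Proof. exact: sqrtr_ge0. Qed.

Lemma enormZ (n : nat) (a : R) (x : 'cV[R]_n) : enorm (a *: x) = `|a| * enorm x.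
Proof.
by rewrite !enormE /dot innerZl innerZr mulrA -expr2 sqrtrM ?sqr_ge0// sqrtr_sqr.
Qed.

Lemma enormN (n : nat) (x : 'cV[R]_n) : enorm (- x) = enorm x.
Proof. by rewrite -scaleN1r enormZ normrN1 mul1r. Qed.

Lemma coord_le_enorm (n : nat) (x : 'cV[R]_n) i : `|x i 0| <= enorm x.
Proof.
rewrite -sqrtr_sqr ler_sqrt ?sumr_ge0//; last by move=> j _; exact: sqr_ge0.
by rewrite (bigD1 i) //= lerDl sumr_ge0// => j _; exact: sqr_ge0.
Qed.

Lemma enorm_eq0 (n : nat) (x : 'cV[R]_n) : (enorm x == 0) = (x == 0).
Proof.
apply/eqP/eqP => [x0|->]; last by rewrite enormE /dot inner0l sqrtr0.
apply/colP => i; apply/eqP; rewrite mxE -normr_eq0 eq_le normr_ge0 andbT.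
by rewrite -x0 coord_le_enorm.
Qed.

Lemma enorm0 (n : nat) : enorm (0 : 'cV[R]_n) = 0.
Proof. by apply/eqP; rewrite enorm_eq0. Qed.

(** The discriminant argument for t -> <x + t y, x + t y>_G. As G is only semidefinite, the leading
    coefficient may vanish for nonzero y; the quadratic is then affine, and nonnegativity forces its
    slope to be zero. *)
Lemma psd_cauchy_schwarz (n : nat) (G : 'M[R]_n) (x y : 'cV[R]_n) :
  G^T = G -> (forall z, 0 <= inner G z z) ->
  inner G x y ^+ 2 <= inner G x x * inner G y y.
Proof.
move=> symG psdG; pose a := inner G x x; pose b := inner G x y.
pose d := inner G y y.
have quad t : 0 <= a + 2 * t * b + t ^+ 2 * d.
  have := psdG (x + t *: y).
  rewrite innerDl !innerDr !innerZl !innerZr (innerC y x symG) -/a -/b -/d.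
  by rewrite (_ : _ + _ = a + 2 * t * b + t ^+ 2 * d) //; ring.
rewrite -/a -/b -/d; have d_ge0 : 0 <= d := psdG y.
have [d0|d_neq0] := eqVneq d 0.
  rewrite d0 mulr0; have [->|b_neq0] := eqVneq b 0; first by rewrite expr0n.
  (* The point where the affine function a + 2 t b takes the value -1. *)
  have := quad (- (a + 1) / (2 * b)); rewrite d0 mulr0 addr0.
  rewrite (_ : a + _ = -1); last by field.
  by rewrite lerNr oppr0 ler10.
have d_gt0 : 0 < d by rewrite lt_def d_neq0.
have := quad (- b / d); rewrite (_ : a + _ + _ = (a * d - b ^+ 2) / d).
  by rewrite pmulr_lge0 ?invr_gt0// subr_ge0.
by field.
Qed.

Lemma dot_le_enorm (n : nat) (x y : 'cV[R]_n) : dot x y <= enorm x * enorm y.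
Proof.
have [xy_le0|/ltW xy_ge0] := lerP (dot x y) 0.
  by rewrite (le_trans xy_le0)// mulr_ge0// enorm_ge0.
rewrite -(ler_pXn2r (n := 2)) ?nnegrE ?mulr_ge0 ?enorm_ge0//.
rewrite exprMn !enorm_sqr; apply: psd_cauchy_schwarz; first by rewrite trmx1.
exact: dot_xx_ge0.
Qed.

(** Cauchy-Schwarz on each row gives the Frobenius norm as a constant; adding 1 keeps it positive
    for A = 0. It serves to show that the suprema below are taken over bounded sets. *)
Lemma mulmx_bounded (m n : nat) (A : 'M[R]_(m, n)) :
  exists2 K : R, 0 < K & forall x, enorm (A *m x) <= K * enorm x.
Proof.
pose S := \sum_i enorm (row i A)^T ^+ 2.
have S_ge0 : 0 <= S by apply: sumr_ge0 => i _; exact: sqr_ge0.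
exists (Num.sqrt S + 1); first by rewrite ltr_wpDl// sqrtr_ge0.
move=> x; apply: (@le_trans _ _ (Num.sqrt S * enorm x)); last first.
  by rewrite ler_wpM2r ?enorm_ge0// lerDl.
rewrite -(ler_pXn2r (n := 2)) ?nnegrE ?mulr_ge0 ?sqrtr_ge0 ?enorm_ge0//.
rewrite exprMn (sqr_sqrtr S_ge0) enorm_sqr dotE mulr_suml; apply: ler_sum => i _.
have -> : (A *m x) i 0 = dot (row i A)^T x.
  by rewrite dotE mxE; apply: eq_bigr => j _; rewrite !mxE.
rewrite -expr2 !enorm_sqr; apply: psd_cauchy_schwarz; first by rewrite trmx1.
exact: dot_xx_ge0.
Qed.

Lemma spectral_norm_bound (m n : nat) (A : 'M[R]_(m, n)) (x : 'cV[R]_n) :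
  enorm (A *m x) <= spectral_norm A * enorm x.
Proof.
have [->|x_neq0] := eqVneq x 0.
  by rewrite mulmx0 !enorm0 mulr0.
have x_gt0 : 0 < enorm x by rewrite lt_def enorm_eq0 x_neq0 enorm_ge0.
rewrite -ler_pdivrMr// mulrC -{1}[(enorm x)^-1]ger0_norm ?invr_ge0 ?enorm_ge0//.
rewrite -enormZ scalemxAr; apply: ub_le_sup.
  have [K K_gt0 AK] := mulmx_bounded A.
  exists K => _ [y y_le1 <-]; rewrite (le_trans (AK y))//.
  by rewrite ler_piMr// ltW.
exists ((enorm x)^-1 *: x) => //=.
by rewrite enormZ ger0_norm ?invr_ge0 ?enorm_ge0// mulVf// gt_eqF.
Qed.

(* The supremum of the admissible constants is itself an eigenvalue: otherwise *)
(* the shifted form is semidefinite and invertible, hence uniformly positive.  *)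
Lemma eigenvalue_inner_ge (n : nat) (G : 'M[R]_n) (lam : R) (x : 'cV[R]_n) :
  G^T = G -> (forall a, eigenvalue G a -> lam <= a) ->
  lam * enorm x ^+ 2 <= inner G x x.
Proof.
move=> symG lamG; have [->|x_neq0] := eqVneq x 0.
  by rewrite inner0l enorm0 expr0n mulr0.
pose S := [set a : R | forall y, a * enorm y ^+ 2 <= inner G y y].
have sqr_gt0 (y : 'cV[R]_n) : y != 0 -> 0 < enorm y ^+ 2.
  by move=> y0; rewrite exprn_gt0// lt_def enorm_eq0 y0 enorm_ge0.
have ubS y : y != 0 -> ubound S (inner G y y / enorm y ^+ 2).
  by move=> y0 a; rewrite ler_pdivlMr ?sqr_gt0//; exact.
have [K K_gt0 GK] := mulmx_bounded G.
have supS : has_sup S.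
  split; last by exists (inner G x x / enorm x ^+ 2); exact: ubS.
  exists (- K) => y; rewrite mulNr lerNl -innerNl inner_dot.
  rewrite (le_trans (dot_le_enorm _ _))// enormN expr2 mulrCA.
  by rewrite ler_wpM2l ?enorm_ge0.
pose mu := sup S; have muS : S mu.
  move=> y; have [->|y0] := eqVneq y 0.
    by rewrite inner0l enorm0 expr0n mulr0.
  by rewrite -ler_pdivlMr ?sqr_gt0//; apply: ge_sup (ubS y y0); case: supS.
suff : eigenvalue G mu.
  by move=> /lamG lam_le; apply: le_trans (muS x); rewrite ler_wpM2r ?sqr_ge0.
rewrite /eigenvalue /eigenspace kermx_eq0 row_free_unit; apply/negP => H_unit.
pose H := G - mu%:M; rewrite -/H in H_unit.
have HE y z : inner H y z = inner G y z - mu * dot y z.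
  by rewrite !inner_dot mulmxBl mul_scalar_mx /dot innerDr innerNr innerZr.
have symH : H^T = H by rewrite linearB /= symG tr_scalar_mx.
have psdH y : 0 <= inner H y y by rewrite HE subr_ge0 -enorm_sqr.
have [M M_gt0 HM] := mulmx_bounded H.
have [N N_gt0 HN] := mulmx_bounded (invmx H).
have H_ge y : enorm (H *m y) ^+ 2 <= M * inner H y y.
  have [Hy0|Hy0] := eqVneq (H *m y) 0.
    by rewrite Hy0 enorm_sqr /dot inner0l mulr_ge0// ltW.
  rewrite -(ler_pM2r (sqr_gt0 _ Hy0)) -expr2.
  rewrite [X in X ^+ 2]enorm_sqr -[dot _ _](inner_dot H) innerC//.
  rewrite (le_trans (psd_cauchy_schwarz _ _ symH psdH))//.
  rewrite [leRHS]mulrAC mulrC ler_wpM2r// inner_dot.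
  rewrite (le_trans (dot_le_enorm _ _))// expr2 mulrA [M * _]mulrC -mulrA.
  by rewrite ler_wpM2l ?enorm_ge0.
have NM_gt0 : 0 < N ^+ 2 * M by rewrite mulr_gt0// exprn_gt0.
(* Invertibility gives |y| <= N |H y|, hence |y|^2 <= N^2 M <y, y>_H by [H_ge]; so [mu] could be
   raised by 1 / (N^2 M), against its being the supremum. *)
suff : S (mu + (N ^+ 2 * M)^-1).
  by move/(ub_le_sup supS.2); rewrite gerDl leNgt invr_gt0 NM_gt0.
move=> y; rewrite mulrDl -lerBrDl enorm_sqr -HE -enorm_sqr mulrC.
rewrite ler_pdivrMr// mulrC -mulrA.
apply: le_trans (_ : N ^+ 2 * enorm (H *m y) ^+ 2 <= _).
  rewrite -exprMn -[in leLHS](mulKmx H_unit y).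
  by rewrite lerXn2r ?nnegrE ?mulr_ge0 ?enorm_ge0 ?(ltW N_gt0).
by rewrite ler_wpM2l// sqr_ge0.
Qed.

(** The lower bound applied to [- G], whose eigenvalues are the opposites of those of [G]. *)
Lemma eigenvalue_inner_le (n : nat) (G : 'M[R]_n) (lam : R) (x : 'cV[R]_n) :
  G^T = G -> (forall a, eigenvalue G a -> a <= lam) ->
  inner G x x <= lam * enorm x ^+ 2.
Proof.
move=> symG lamG.
have innerN y z : inner (- G) y z = - inner G y z.
  by rewrite !inner_dot mulNmx /dot innerNr.
rewrite -lerN2 -innerN -mulNr.
apply: eigenvalue_inner_ge; first by rewrite linearN /= symG.
move=> a /eigenvalueP [u uG u0]; rewrite lerNl; apply: lamG.
apply/eigenvalueP; exists u => //.
by rewrite -[G]opprK mulmxN uG scaleNr.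
Qed.

(** Cauchy-Schwarz for G gives |Gx|^4 = <x, Gx>_G^2 <= <x, x>_G <Gx, Gx>_G <= <x, x>_G lam |Gx|^2;
    then |Gx|^2 is cancelled. *)
Lemma enorm_mulmx_sqr_le (n : nat) (G : 'M[R]_n) (lam : R) (x : 'cV[R]_n) :
  G^T = G -> (forall z, 0 <= inner G z z) ->
  (forall z, inner G z z <= lam * enorm z ^+ 2) ->
  enorm (G *m x) ^+ 2 <= lam * inner G x x.
Proof.
move=> symG psdG Glam; have [Gx0|Gx0] := eqVneq (G *m x) 0.
  by rewrite inner_dot Gx0 enorm0 dotC /dot inner0l expr0n mulr0.
have Gx_gt0 : 0 < enorm (G *m x) ^+ 2.
  by rewrite exprn_gt0// lt_def enorm_eq0 Gx0 enorm_ge0.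
rewrite -(ler_pM2r Gx_gt0) -expr2 [X in X ^+ 2]enorm_sqr.
rewrite -[dot _ _](inner_dot G) innerC//.
rewrite (le_trans (psd_cauchy_schwarz _ _ symG psdG))//.
by rewrite [leRHS]mulrAC mulrC ler_wpM2r.
Qed.

End InnerProducts.

(** * Derivatives along lines, the descent lemma and first-order convexity *)

Section Calculus.
Context {R : realType} {n : nat}.
Implicit Types (f : 'cV[R]_n -> R) (x y d : 'cV[R]_n).

Lemma derive_grad f x d :
  differentiable f x -> 'D_d f x = dot (grad f x) d.
Proof.
move=> df; rewrite deriveE// {1}[d]matrix_sum_delta linear_sum dotE.
apply: eq_bigr => i _; rewrite big_ord1 linearZ /= mxE deriveE//.
by rewrite mulrC.
Qed.

(** Identifies one-variable difference quotients along a line with directional ones, so derivatives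
    along lines need no chain rule. *)
Lemma growth_rate_line f x d (t : R) :
  (fun h : R => h^-1 *: (f (x + (h *: 1 + t) *: d) - f (x + t *: d))) =
  (fun h : R => h^-1 *: (f (h *: d + (x + t *: d)) - f (x + t *: d))).
Proof.
apply/funext => h; congr (_ *: (f _ - _)).
by rewrite scalerDl /GRing.scale /= mulr1 addrCA.
Qed.

Lemma is_derive_line f x d (t : R) :
  differentiable f (x + t *: d) ->
  is_derive t 1 (fun s : R => f (x + s *: d)) (dot (grad f (x + t *: d)) d).
Proof.
move=> df; rewrite -derive_grad//; apply: DeriveDef.
  by rewrite /derivable growth_rate_line; exact: diff_derivable.
by rewrite /derive growth_rate_line.
Qed.

Lemma grad_sqrt_shift f (c : R) x :
  differentiable f x -> 0 < f x + c ->
  grad (sqrt_shift f c) x = (2 * sqrt_shift f c x)^-1 *: grad f x.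
Proof.
move=> df fc_gt0; apply/colP => i; rewrite !mxE.
set e := delta_mx i 0.
(* Restriction to a coordinate line reduces the claim to the one-variable chain rule with
   [Num.sqrt]. *)
have line0 (g : 'cV[R]_n -> R) : 'D_e g x = 'D_1 (fun s : R => g (x + s *: e)) 0.
  have x0 : x = x + 0 *: e by rewrite scale0r addr0.
  by rewrite {1}x0 /derive growth_rate_line.
have dg : is_derive (0 : R) 1 (fun s : R => f (x + s *: e)) ('D_e f x).
  rewrite derive_grad// -{2}[x]addr0 -(scale0r e); apply: is_derive_line.
  by rewrite scale0r addr0.
set g := fun s : R => _ in dg.
have dgc : is_derive (0 : R) 1 (g + cst c) ('D_e f x).
  by apply: is_derive_eq; exact: addr0.
have gc0 : (g + cst c) 0 = f x + c by rewrite /g /= fctE scale0r addr0.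
have dsqrt : is_derive ((g + cst c) 0) 1 Num.sqrt (2 * sqrt_shift f c x)^-1.
  by rewrite gc0; exact: is_derive1_sqrt.
by rewrite line0; exact: (derive_val (is_derive := is_derive1_comp dsqrt dgc)).
Qed.

(** The Hessian exists but need not be continuous, so two applications of the mean value theorem
    replace the integral remainder: one bounds the growth of the slope [psi], the other bounds
    [phi]. *)
Lemma smooth_descent f (alpha : R) x d :
  (forall y, differentiable f y) -> smooth alpha f ->
  f (x + d) <= f x + dot (grad f x) d + alpha / 2 * enorm d ^+ 2.
Proof.
move=> df [dgrad hess_le].
pose phi (t : R) := f (x + t *: d).
pose psi (t : R) := dot (grad f (x + t *: d)) d.
have dphi (t : R) : is_derive t 1 phi (psi t) by exact: is_derive_line.
have dpsi (t : R) : is_derive t 1 psi (dot (hess f (x + t *: d) *m d) d).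
  pose gi i y := grad f y i 0.
  have dgi i y : differentiable (gi i) y.
    exact: (differentiable_comp (dgrad y) (differentiable_coord (grad f y) i 0)).
  have -> : psi = \sum_(i < n) (fun s : R => gi i (x + s *: d) * d i 0).
    by apply/funext => s; rewrite /psi dotE fct_sumE.
  rewrite dotE; apply: is_derive_sum => i.
  have di := is_derive_line (dgi i (x + t *: d)).
  apply: is_derive_eq.
  rewrite scaler0 add0r mulrC; congr (_ * _).
  by rewrite dotE mxE; apply: eq_bigr => j _; rewrite !mxE.
have K_ge (t : R) : dot (hess f (x + t *: d) *m d) d <= alpha * enorm d ^+ 2.
  rewrite (le_trans (dot_le_enorm _ _))// expr2 mulrA ler_wpM2r ?enorm_ge0//.
  rewrite (le_trans (spectral_norm_bound _ _))//.
  by rewrite ler_wpM2r ?enorm_ge0.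
pose K := alpha * enorm d ^+ 2.
have psi_le (t : R) : 0 < t -> psi t - psi 0 <= K * t.
  move=> t_gt0; have [|c _ ->] := MVT t_gt0 (fun s _ => dpsi s).
    by apply: derivable_within_continuous => s _; exact: ex_derive.
  by rewrite subr0 ler_wpM2r// ltW.
(* By [psi_le] the derivative of [h] is nonpositive for t > 0, so h 1 <= h 0, which is the claim. *)
pose h (t : R) := phi t - psi 0 * t - K / 2 * t ^+ 2.
have dh (t : R) : is_derive t 1 h (psi t - psi 0 - K * t).
  apply: is_derive_eq; rewrite /GRing.scale /=.
  by move: (psi t) (psi 0) (K) => a a0 k; field.
have [|s /andP[s_gt0 _]] := MVT ltr01 (fun s _ => dh s).
  by apply: derivable_within_continuous => s _; exact: ex_derive.
rewrite subr0 mulr1 => h1; move: (psi_le s s_gt0); rewrite -subr_le0 -{}h1.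
rewrite /h /phi /psi scale1r scale0r addr0 expr0n expr1n /K /=.
move: (f (x + d)) (f x) (dot _ d) (_ ^+ 2) => a a0 p q.
lra.
Qed.

(** For 0 < h <= 1 convexity bounds the difference quotient in direction y - x by f y - f x; the
    bound survives the limit from the right. *)
Lemma convex_gradient f x y :
  differentiable f x -> convex_function [set: convex_lmodType 'cV[R]_n] f ->
  f x + dot (grad f x) (y - x) <= f y.
Proof.
move=> df cvf; rewrite -lerBrDl -derive_grad//.
have dfd : derivable f x (y - x) by exact: diff_derivable.
have Dcvg := cvg_dnbhs_at_right dfd.
apply: cvgr_to_le Dcvg _; near=> h.
have h_gt0 : 0 < h by near: h; exact: nbhs_right_gt.
have h_le1 : h <= 1 by near: h; exact: nbhs_right_le.
rewrite /= /GRing.scale /= mulrC ler_pdivrMr// lerBlDr.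
have -> : scalemx h (y - x) + x = h *: y + (1 - h) *: x.
  by rewrite -/(h *: (y - x)) scalerBr scalerBl scale1r addrAC addrA.
have -> : (f y - f x) * h + f x = h * f y + (1 - h) * f x by ring.
by apply: (cvf (Itv01 (ltW h_gt0) h_le1)); rewrite inE.
Unshelve. all: by end_near. Qed.

End Calculus.

(** * The G-orthogonal projection onto the kernel of B *)

Section Projection.
Context {R : realType} {m n : nat}.
Implicit Types (B : 'M[R]_(m, n)) (G P : 'M[R]_n) (g x y : 'cV[R]_n).

Lemma dot_inj x y : (forall z, dot x z = dot y z) -> x = y.
Proof.
move=> xy; apply/eqP; rewrite -subr_eq0 -enorm_eq0 -sqrf_eq0 enorm_sqr.
by rewrite /dot innerDl innerNl -/(dot x _) xy -/(dot y _) subrr.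
Qed.

Lemma normr_dot_le x y : `|dot x y| <= enorm x * enorm y.
Proof.
rewrite ler_norml dot_le_enorm andbT lerNl /dot -innerNl -(enormN x).
exact: dot_le_enorm.
Qed.

(** The residual x - P x lies in ker B and is G-orthogonal to ker B, hence to itself. *)
Lemma orth_proj_ker_id G B P x :
  sym_posdef G -> orth_proj_ker G B P -> B *m x = 0 -> P *m x = x.
Proof.
move=> [_ posG] [BP orthP] Bx; apply/eqP; rewrite eq_sym -subr_eq0.
apply: contraT => /posG; rewrite orthP ?ltxx//.
by rewrite mulmxBr Bx BP subr0.
Qed.

Lemma orth_proj_ker_dot G B P g y :
  sym_posdef G -> orth_proj_ker G B P -> B *m y = 0 ->
  dot (P^T *m g) y = dot g y.
Proof. by move=> Gpd PP By; rewrite dot_trmx (orth_proj_ker_id Gpd PP). Qed.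

(* A [G]-orthogonal projection is self-adjoint for [G], i.e. [G P = P^T G]. *)
Lemma orth_proj_ker_solve G B P g :
  sym_posdef G -> G \in unitmx -> orth_proj_ker G B P ->
  G *m (P *m invmx G *m g) = P^T *m g.
Proof.
move=> [symG _] G_unit [BP orthP].
apply: dot_inj => z; rewrite -mulmxA; set u := invmx G *m g.
have orth x y : inner G x (P *m y) = inner G (P *m x) (P *m y).
  apply/eqP; rewrite -subr_eq0 -innerNl -innerDl; apply/eqP/orthP; exact: BP.
rewrite dotC -inner_dot orth innerC// -orth innerC// inner_dot mulKVmx//.
by rewrite dot_trmx dotC.
Qed.

End Projection.

(** * Series, recursions and cluster points *)

Section Sequences.
Context {R : realType}.
Implicit Types (u w g : nat -> R).

Lemma nneseries_le_bound u (M : R) :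
  (forall k, 0 <= u k) -> (forall N, \sum_(0 <= k < N) u k <= M) ->
  (\sum_(0 <= k <oo) (u k)%:E <= M%:E)%E.
Proof.
move=> u_ge0 uM; apply: lime_le.
  by apply: is_cvg_nneseries => k _ _; rewrite lee_fin.
by apply: nearW => N; rewrite /= sumEFin lee_fin.
Qed.

(** The usual O(1/k) recursion, proved by induction instead of by summing reciprocals of w, so
    vanishing gaps do no harm. *)
Lemma sublinear_rate (w p : nat -> R) (b D : R) (k : nat) :
  0 < b -> 0 <= D -> (forall j, 0 <= w j) ->
  (forall j, (j < k)%N -> w j <= D * p j) ->
  (forall j, (j < k)%N -> w j.+1 <= w j - b * p j ^+ 2) ->
  k%:R * b * w k <= D ^+ 2.
Proof.
move=> b_gt0 D_ge0 w_ge0; elim: k => [|k IHk] wp step.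
  by rewrite !mul0r sqr_ge0.
have {}IHk : k%:R * (b * w k) <= D ^+ 2.
  by rewrite mulrA; apply: IHk => j /ltnW; [exact: wp|exact: step].
have wpk := wp k (ltnSn k); have stepk := step k (ltnSn k).
have [D0|D_neq0] := eqVneq D 0.
  have w0 : w k = 0.
    by apply/eqP; rewrite eq_le w_ge0 andbT (le_trans wpk)// D0 mul0r.
  rewrite (le_trans _ (sqr_ge0 D))// mulr_ge0_le0//.
    by rewrite mulr_ge0// ltW.
  rewrite (le_trans stepk)// w0 sub0r oppr_le0 mulr_ge0 ?sqr_ge0//.
  exact: ltW.
have D2_gt0 : 0 < D ^+ 2 by rewrite exprn_gt0// lt_def D_neq0.
have wpk2 : w k ^+ 2 <= D ^+ 2 * p k ^+ 2.
  by rewrite -exprMn lerXn2r ?nnegrE// (le_trans (w_ge0 k)).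
have y_ge0 : 0 <= b * w k by rewrite mulr_ge0// ltW.
rewrite -(ler_pM2r D2_gt0) -expr2 -natr1.
(* With y = b w_k, the two hypotheses give D^2 b w_{k+1} <= y (D^2 - y). If y <= D^2, induction
   gives (k + 1) y <= D^2 + y, and the product is at most D^4 - y^2; otherwise it is nonpositive. *)
apply: (@le_trans _ _ ((k%:R + 1) * (b * w k) * (D ^+ 2 - b * w k))).
  rewrite -[leLHS]mulrA -[leLHS]mulrA -[leRHS]mulrA ler_wpM2l ?addr_ge0//.
  rewrite -[leRHS]mulrA ler_wpM2l ?(ltW b_gt0)//.
  have := ler_wpM2l (ltW D2_gt0) stepk; have := ler_wpM2l (ltW b_gt0) wpk2.
  lra.
move: IHk y_ge0 (w_ge0 k); move: (b * w k) => y.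
have [yD|Dy] := leP y (D ^+ 2) => IHk y_ge0 _.
  apply: (@le_trans _ _ ((D ^+ 2 + y) * (D ^+ 2 - y))).
    by rewrite ler_wpM2r ?subr_ge0// mulrDl mul1r lerD2r.
  by rewrite mulrC -subr_sqr gerBl sqr_ge0.
rewrite (le_trans _ (sqr_ge0 _))// mulr_ge0_le0 ?subr_le0 ?(ltW Dy)//.
by rewrite mulr_ge0// addr_ge0.
Qed.

Lemma geometric_sum_le (q : R) (N : nat) :
  0 <= q -> q < 1 -> \sum_(0 <= k < N) q ^+ k <= (1 - q)^-1.
Proof.
move=> q_ge0 q_lt1; have q1 : 0 < 1 - q by rewrite subr_gt0.
rewrite -[leRHS]mul1r ler_pdivlMr// mulrC big_mkord.
by rewrite -(opprB q 1) mulNr -subrX1 opprB gerBl exprn_ge0.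
Qed.

Lemma cvgr0_bound (u w : nat -> R) :
  (forall k, `|u k| <= w k) -> w @ \oo --> 0 -> u @ \oo --> 0.
Proof.
move=> uw w0; apply: (@squeeze_cvgr _ _ _ _ (fun k => - w k) w) => //.
  by apply: nearW => k; rewrite -ler_norml.
by rewrite -oppr0; exact: cvgN.
Qed.

(** Passes limits to cluster points without extracting subsequences: the set where g is near y meets
    every neighbourhood of x. *)
Lemma cluster_cvg_eq (T : topologicalType) (F : set_system T) {FF : Filter F}
    (g : T -> R) (x : T) (y : R) :
  {for x, continuous g} -> g @ F --> y -> cluster F x -> g x = y.
Proof.
move=> gx gy Fx; apply/eqP; rewrite -subr_eq0 -normr_le0.
apply/ler_addgt0Pr => e e_gt0; rewrite add0r.
have e2_gt0 : 0 < e / 2 by rewrite divr_gt0.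
have near_y : F [set t | `|y - g t| < e / 2].
  by move/cvgrPdist_lt : gy => /(_ _ e2_gt0).
have near_x : nbhs x [set t | `|g x - g t| < e / 2].
  by move/cvgrPdist_lt : gx => /(_ _ e2_gt0).
have [t [/= yt xt]] := Fx _ _ near_y near_x.
rewrite -(subrKA (g t)) (le_trans (ler_normD _ _))// [leRHS]splitr.
by rewrite lerD// ltW// distrC.
Qed.

Lemma dot_continuous (n : nat) (a : 'cV[R]_n) : continuous (fun x => dot x a).
Proof.
have -> : (fun x => dot x a) = (fun x => \sum_(i < n) x i 0 * a i 0).
  by apply/funext => x; exact: dotE.
apply: continuous_big => [|i _ x]; first exact: add_continuous.
exact: (cvgMr_tmp (@coord_continuous R n 1 i 0 x)).
Qed.

Lemma cvg_of_summable_steps (n : nat) (x : nat -> 'cV[R]_n) (M : R) :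
  (forall N, \sum_(0 <= k < N) enorm (x k.+1 - x k) <= M) -> cvgn x.
Proof.
move=> xM.
have -> : x = (fun k => x 0%N + series (telescope x) k).
  by apply/funext => k; exact: eq_sum_telescope.
apply: is_cvgD; first exact: is_cvg_cst.
pose V : completeNormedModType R := HB.pack 'cV[R]_n (Complete.on 'cV[R]_n).
apply: (@normed_cvg R V); apply: nondecreasing_is_cvgn.
  by apply: nondecreasing_series => k _ _; exact: normr_ge0.
exists M => _ [N _ <-] /=; apply: le_trans (xM N); rewrite /series /=.
(* Absolute convergence is needed in the library sup norm, which [enorm] dominates. *)
apply: ler_sum => k _; rewrite [leLHS]/Num.norm /= mx_normrE.
apply: bigmax_le => [|[i j] _ /=]; first exact: enorm_ge0.
by rewrite ord1 coord_le_enorm.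
Qed.

End Sequences.

(** * The iteration: energy law and projected gradient *)

Section Iteration.
Context {R : realType} {m n : nat}.
Variables (L : 'cV[R]_n -> R) (c : R) (B : 'M[R]_(m, n)) (b : 'cV[R]_m).
Variables (G P : 'cV[R]_n -> 'M[R]_n) (lam1 lamn eta : R).
Variables (theta v : nat -> 'cV[R]_n) (r : nat -> R).

Local Notation Theta := (affine_set B b).
Local Notation lstar := (sqrt_shift_inf L c Theta).
Local Notation l k := (sqrt_shift L c (theta k)).
Local Notation q k := (inner (G (theta k)) (v k) (v k)).
Local Notation delta k := (theta k.+1 - theta k).
Local Notation Pgrad x := ((P x)^T *m grad L x).

Hypothesis L_C1 : class_C1 L.
Hypothesis L_bounded_below : has_lbound (range L).
Hypothesis Lc_gt0 : 0 < inf (range (fun x => L x + c)).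
Hypothesis lam1_gt0 : 0 < lam1.
Hypothesis lam1_le_lamn : lam1 <= lamn.
Hypothesis G_spd : forall x, Theta x -> sym_posdef (G x).
Hypothesis G_spectrum : forall x, Theta x ->
  forall a : R, eigenvalue (G x) a -> lam1 <= a /\ a <= lamn.
Hypothesis P_proj : forall x, Theta x -> orth_proj_ker (G x) B (P x).
Hypothesis theta0 : Theta (theta 0%N).
Hypothesis r0_gt0 : 0 < r 0%N.
Hypothesis eta_gt0 : 0 < eta.
Hypothesis v_def : forall k, v k =
  P (theta k) *m invmx (G (theta k)) *m grad (sqrt_shift L c) (theta k).
Hypothesis r_step : forall k, r k.+1 = r k / (1 + 2 * eta * enorm (v k) ^+ 2).
Hypothesis theta_step : forall k,
  theta k.+1 = theta k - (2 * eta * r k.+1) *: v k.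

Let lamn_gt0 : 0 < lamn := lt_le_trans lam1_gt0 lam1_le_lamn.

Lemma r_denom_gt0 k : 0 < 1 + 2 * eta * enorm (v k) ^+ 2.
Proof. by rewrite ltr_pwDl// mulr_ge0 ?sqr_ge0// mulr_ge0// ltW. Qed.

Lemma r_gt0 k : 0 < r k.
Proof. by elim: k => // k IHk; rewrite r_step divr_gt0// r_denom_gt0. Qed.

(** The source of all telescoping: |v_k|^2 is traded for a difference of r. *)
Lemma r_decrement k : r k - r k.+1 = 2 * eta * r k.+1 * enorm (v k) ^+ 2.
Proof.
have rk : r k = r k.+1 * (1 + 2 * eta * enorm (v k) ^+ 2).
  by rewrite r_step divfK// gt_eqF// r_denom_gt0.
by rewrite {1}rk; ring.
Qed.

Lemma r_step_le k : r k.+1 <= r k.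
Proof.
rewrite -subr_ge0 r_decrement mulr_ge0 ?sqr_ge0//.
by rewrite mulr_ge0 ?(ltW (r_gt0 _))// mulr_ge0// ltW.
Qed.

Lemma r_step_lt k : v k != 0 -> r k.+1 < r k.
Proof.
move=> vk; rewrite -subr_gt0 r_decrement mulr_gt0//.
  by rewrite mulr_gt0 ?r_gt0// mulr_gt0.
by rewrite exprn_gt0// lt_def enorm_eq0 vk enorm_ge0.
Qed.

Lemma r_nonincreasing : nonincreasing_seq r.
Proof. exact/nonincreasing_seqP/r_step_le. Qed.

Lemma r_is_cvg : cvgn r.
Proof.
apply: nonincreasing_is_cvgn r_nonincreasing _.
by exists 0 => _ [k _ <-]; exact: ltW (r_gt0 k).
Qed.

Lemma rlim_le k : limn r <= r k.
Proof. exact: nonincreasing_cvgn_ge r_nonincreasing r_is_cvg k. Qed.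

Lemma delta_scale k : delta k = - (2 * eta * r k.+1) *: v k.
Proof. by rewrite theta_step addrAC subrr add0r scaleNr. Qed.

Lemma enorm_delta k : enorm (delta k) = 2 * eta * r k.+1 * enorm (v k).
Proof.
rewrite delta_scale enormZ normrN ger0_norm//.
by rewrite mulr_ge0 ?(ltW (r_gt0 _))// mulr_ge0// ltW.
Qed.

Lemma enorm_delta_sqr k :
  enorm (delta k) ^+ 2 = 2 * eta * r k.+1 * (r k - r k.+1).
Proof. by rewrite enorm_delta r_decrement; ring. Qed.

(** The polarization 2 a (b - a) = b^2 - a^2 - (b - a)^2 with a = r_{k+1} and b = r_k. *)
Lemma energy_identity k :
  r k.+1 ^+ 2 = r k ^+ 2 - (r k.+1 - r k) ^+ 2 - eta^-1 * enorm (delta k) ^+ 2.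
Proof.
by rewrite enorm_delta_sqr; field; rewrite gt_eqF.
Qed.

(** Kept as an equality because the subtracted squares later give strict positivity of the limit of
    r. *)
Lemma sum_delta_sqr N :
  \sum_(0 <= k < N) enorm (delta k) ^+ 2 =
  eta * (r 0%N ^+ 2 - r N ^+ 2 - \sum_(0 <= k < N) (r k.+1 - r k) ^+ 2).
Proof.
elim: N => [|N IHN]; first by rewrite !big_nil; ring.
by rewrite !big_nat_recr//= IHN enorm_delta_sqr; ring.
Qed.

Lemma sum_delta_sqr_le N :
  \sum_(0 <= k < N) enorm (delta k) ^+ 2 <= eta * r 0%N ^+ 2.
Proof.
rewrite sum_delta_sqr ler_pM2l// -addrA gerDl -opprD oppr_le0.
by rewrite addr_ge0 ?sqr_ge0// sumr_ge0// => k _; exact: sqr_ge0.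
Qed.

(** The squared step is at most 2 eta r_0 (r_k - r_{k+1}), and r converges. *)
Lemma enorm_delta_cvg0 : (fun k => enorm (delta k)) @ \oo --> 0.
Proof.
apply: (@cvgr0_bound _ _ (fun k => Num.sqrt (2 * eta * r 0%N * (r k - r k.+1)))).
  move=> k; rewrite ger0_norm ?enorm_ge0//.
  rewrite -[leLHS]ger0_norm ?enorm_ge0// -sqrtr_sqr ler_sqrt.
    rewrite enorm_delta_sqr ler_wpM2r ?subr_ge0 ?r_step_le//.
    by rewrite ler_wpM2l ?r_nonincreasing// mulr_ge0// ltW.
  rewrite mulr_ge0 ?subr_ge0 ?r_step_le// mulr_ge0 ?(ltW r0_gt0)//.
  by rewrite mulr_ge0// ltW.
rewrite -[X in _ --> X]sqrtr0.
apply: continuous_cvg; first exact: sqrt_continuous.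
rewrite -[X in _ --> X](mulr0 (2 * eta * r 0%N)); apply: cvgMl_tmp.
rewrite -(subrr (limn r)); apply: cvgB; first exact: r_is_cvg.
by rewrite (cvg_shiftS r); exact: r_is_cvg.
Qed.

(** Uniformity of the bound is what lets positivity pass to the infimum over Theta in
    [lstar_gt0]. *)
Lemma L_shift_lb : exists2 e : R, 0 < e & forall x, e <= L x + c.
Proof.
exists (inf (range (fun x => L x + c))) => // x.
apply: ge_inf; last by exists x.
have [M ML] := L_bounded_below; exists (M + c) => _ [y _ <-].
by rewrite lerD2r ML//; exists y.
Qed.

Lemma L_shift_gt0 x : 0 < L x + c.
Proof. by have [e e_gt0 eL] := L_shift_lb; exact: lt_le_trans (eL x). Qed.

Lemma l_sqr x : sqrt_shift L c x ^+ 2 = L x + c.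
Proof. by rewrite sqr_sqrtr// ltW// L_shift_gt0. Qed.

Lemma l_gt0 x : 0 < sqrt_shift L c x.
Proof. by rewrite sqrtr_gt0 L_shift_gt0. Qed.

Lemma lstar_gt0 : 0 < lstar.
Proof.
rewrite sqrtr_gt0; have [e e_gt0 eL] := L_shift_lb.
rewrite (lt_le_trans e_gt0)// -lerBlDr; apply: lb_le_inf.
  by exists (L (theta 0%N)); exists (theta 0%N).
by move=> _ [y _ <-]; rewrite lerBlDr.
Qed.

Lemma lstar_le x : Theta x -> lstar <= sqrt_shift L c x.
Proof.
move=> Tx; rewrite ler_sqrt ?(ltW (L_shift_gt0 _))// lerD2r.
apply: ge_inf; last by exists x.
by have [M ML] := L_bounded_below; exists M => _ [y _ <-]; apply: ML; exists y.
Qed.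

Lemma iterates_feasible k : Theta (theta k).
Proof.
elim: k => // k IHk; rewrite /affine_set /= theta_step mulmxBr -scalemxAr.
have [BP _] := P_proj IHk.
by rewrite v_def -!mulmxA BP scaler0 subr0 IHk.
Qed.

Lemma v_ker k : B *m v k = 0.
Proof.
have [BP _] := P_proj (iterates_feasible k).
by rewrite v_def -!mulmxA BP.
Qed.

Lemma G_sym x : Theta x -> (G x)^T = G x.
Proof. by move=> /G_spd[]. Qed.

Lemma G_ge x y : Theta x -> lam1 * enorm y ^+ 2 <= inner (G x) y y.
Proof.
move=> Tx; apply: eigenvalue_inner_ge (G_sym Tx) _.
by move=> a /(G_spectrum Tx)[].
Qed.

Lemma G_le x y : Theta x -> inner (G x) y y <= lamn * enorm y ^+ 2.
Proof.
move=> Tx; apply: eigenvalue_inner_le (G_sym Tx) _.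
by move=> a /(G_spectrum Tx)[].
Qed.

Lemma G_ge0 x y : Theta x -> 0 <= inner (G x) y y.
Proof.
by move=> Tx; rewrite (le_trans _ (G_ge _ Tx))// mulr_ge0 ?sqr_ge0// ltW.
Qed.

Lemma G_unit x : Theta x -> G x \in unitmx.
Proof.
move=> Tx; apply/negPn/negP => G_sing.
have /(G_spectrum Tx)[+ _] : eigenvalue (G x) 0.
  rewrite /eigenvalue /eigenspace kermx_eq0 row_free_unit.
  by rewrite raddf0 subr0.
by rewrite leNgt lam1_gt0.
Qed.

Lemma grad_l x : grad (sqrt_shift L c) x = (2 * sqrt_shift L c x)^-1 *: grad L x.
Proof. by apply: grad_sqrt_shift (L_shift_gt0 x); case: L_C1. Qed.

(** From grad L = 2 l grad l and G P = P^T G; it converts statements about the projected gradient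
    into statements about the step. *)
Lemma Pgrad_Gv k : Pgrad (theta k) = (2 * l k) *: (G (theta k) *m v k).
Proof.
have Tk := iterates_feasible k.
rewrite v_def (orth_proj_ker_solve _ (G_spd Tk) (G_unit Tk) (P_proj Tk)).
rewrite grad_l -scalemxAr scalerA divff ?scale1r//.
by rewrite mulf_neq0// gt_eqF// l_gt0.
Qed.

Lemma Pgrad_dot x y : Theta x -> B *m y = 0 ->
  dot (Pgrad x) y = dot (grad L x) y.
Proof. by move=> Tx; apply: orth_proj_ker_dot (G_spd Tx) (P_proj Tx). Qed.

Lemma grad_dot_v k : dot (grad L (theta k)) (v k) = 2 * l k * q k.
Proof.
rewrite -Pgrad_dot ?v_ker//; last exact: iterates_feasible.
by rewrite Pgrad_Gv /dot innerZl -/(dot _ _) dotC -inner_dot.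
Qed.

(** Keeping the form [q k] costs only one factor [lamn], hence the first power of [lamn] in the PL
    and convex rates; passing to |v_k|^2, as in [Pgrad_sqr_le_v], costs a second one. *)
Lemma Pgrad_sqr_le k :
  enorm (Pgrad (theta k)) ^+ 2 <= 4 * l k ^+ 2 * (lamn * q k).
Proof.
have Tk := iterates_feasible k.
rewrite Pgrad_Gv enormZ exprMn real_normK ?num_real// exprMn -natrX.
rewrite ler_wpM2l ?mulr_ge0 ?(ltW (l_gt0 _))//.
apply: enorm_mulmx_sqr_le (G_sym Tk) _ _.
  by move=> z; exact: G_ge0.
by move=> z; exact: G_le.
Qed.

Lemma Pgrad_sqr_le_v k :
  enorm (Pgrad (theta k)) ^+ 2 <=
  4 * lamn ^+ 2 * (L (theta k) + c) * enorm (v k) ^+ 2.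
Proof.
apply: le_trans (Pgrad_sqr_le k) _; rewrite l_sqr.
have := G_le (v k) (iterates_feasible k).
rewrite -(ler_pM2l lamn_gt0) -(ler_pM2l (L_shift_gt0 (theta k))).
lra.
Qed.

(** For j < k, r_{j+1} >= r_k, so min * 2 eta r_k is at most a constant times r_j - r_{j+1}; the sum
    over j telescopes. The default values are the j = 0 terms, so these are the true minimum and
    maximum. *)
Lemma min_Pgrad_rate k : (1 <= k)%N ->
  \big[Num.min/enorm (Pgrad (theta 0%N)) ^+ 2]_(j < k)
     (enorm (Pgrad (theta j)) ^+ 2)
  <= 2 * r 0%N * lamn ^+ 2 / (eta * r k * k%:R)
     * (\big[Num.max/L (theta 0%N)]_(j < k) L (theta j) + c).
Proof.
move=> k_gt0; set mn := \big[_/_]_(j < k) _; set mx := \big[_/_]_(j < k) _.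
have mxc_ge0 : 0 <= mx + c.
  by rewrite (le_trans (ltW (L_shift_gt0 (theta 0%N))))// lerD2r bigmax_ge_id.
have term j : (j < k)%N ->
    mn * (2 * eta * r k) <= 4 * lamn ^+ 2 * (mx + c) * (r j - r j.+1).
  move=> jk; rewrite r_decrement.
  have mn_le : mn <= 4 * lamn ^+ 2 * (mx + c) * enorm (v j) ^+ 2.
    apply: le_trans (bigmin_le _ (Ordinal jk) _) _.
    apply: le_trans (Pgrad_sqr_le_v j) _; rewrite ler_wpM2r ?sqr_ge0//.
    rewrite ler_wpM2l ?mulr_ge0 ?(ltW lamn_gt0)// lerD2r.
    exact: (le_bigmax _ _ (Ordinal jk)).
  have mn_ge0 : 0 <= mn.
    apply/bigmin_geP; split => [|i _]; exact: sqr_ge0.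
  apply: le_trans (_ : mn * (2 * eta * r j.+1) <= _).
    by rewrite ler_wpM2l// ler_wpM2l ?mulr_ge0 ?(ltW eta_gt0)// r_nonincreasing.
  rewrite [leRHS](_ : _ = 4 * lamn ^+ 2 * (mx + c) * enorm (v j) ^+ 2 *
    (2 * eta * r j.+1)); last by ring.
  by rewrite ler_wpM2r// !mulr_ge0 ?(ltW (r_gt0 _))// ltW.
have : \sum_(0 <= j < k) mn * (2 * eta * r k) <=
    \sum_(0 <= j < k) 4 * lamn ^+ 2 * (mx + c) * (r j - r j.+1).
  by apply: ler_sum_nat => i /andP[_ ik]; exact: term.
rewrite sumr_const_nat subn0 -mulr_sumr.
rewrite (telescope_sumr_eq (fun j => - r j)) => [|//|j _]; last first.
  by rewrite opprK addrC.
rewrite opprK [- r k + _]addrC => sum_le.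
have den_gt0 : 0 < eta * r k * k%:R.
  by rewrite !mulr_gt0 ?r_gt0// ltr0n.
rewrite mulrAC ler_pdivlMr//.
have le_r0 : 4 * lamn ^+ 2 * (mx + c) * (r 0%N - r k) <=
    4 * lamn ^+ 2 * (mx + c) * r 0%N.
  by rewrite ler_wpM2l ?gerBl ?(ltW (r_gt0 _))// !mulr_ge0 ?(ltW lamn_gt0).
move: (le_trans sum_le le_r0); rewrite -mulr_natr; lra.
Qed.

(** * Smooth L: descent of L and of its square root *)

Section Smooth.
Variable alpha : R.
Hypothesis alpha_gt0 : 0 < alpha.
Hypothesis L_smooth : smooth alpha L.

Lemma L_descent k :
  L (theta k.+1) <= L (theta k) - 4 * eta * r k.+1 * (l k * q k)
                    + alpha / 2 * enorm (delta k) ^+ 2.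
Proof.
have := smooth_descent (theta k) (delta k) L_C1.1 L_smooth.
rewrite addrC subrK {1}delta_scale /dot innerZr -/(dot _ _) grad_dot_v.
lra.
Qed.

(** [L_descent] divided by 2 l_k: the first-order term becomes a multiple of r_{k+1} - r_k through
    <v, v>_G >= lam1 |v|^2, and l_k >= lstar controls the quadratic one. *)
Lemma l_descent k :
  l k.+1 - l k <= lam1 * (r k.+1 - r k)
                  + alpha / (4 * lstar) * enorm (delta k) ^+ 2.
Proof.
have lk_gt0 := l_gt0 (theta k); have ls_gt0 := lstar_gt0.
(* Concavity of the square root, obtained from (l_{k+1} - l_k)^2 >= 0 and l^2 = L + c. *)
have descent : 2 * l k * (l k.+1 - l k) <=
    - (4 * eta * r k.+1 * (l k * q k)) + alpha / 2 * enorm (delta k) ^+ 2.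
  have := L_descent k; have := l_sqr (theta k); have := l_sqr (theta k.+1).
  have := sqr_ge0 (l k.+1 - l k); rewrite sqrrB; lra.
have l2_gt0 : 0 < 2 * l k by rewrite mulr_gt0.
rewrite -(ler_pM2l l2_gt0) (le_trans descent)// mulrDr lerD//.
  have -> : r k.+1 - r k = - (2 * eta * r k.+1 * enorm (v k) ^+ 2).
    by rewrite -r_decrement opprB.
  rewrite !mulrN lerN2.
  have c_ge0 : 0 <= 4 * eta * r k.+1 * l k.
    by rewrite !mulr_ge0 ?(ltW (r_gt0 _))// ltW.
  have := ler_wpM2l c_ge0 (G_ge (v k) (iterates_feasible k)).
  lra.
have -> : 2 * l k * (alpha / (4 * lstar) * enorm (delta k) ^+ 2) =
    alpha / 2 * enorm (delta k) ^+ 2 * (l k / lstar).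
  by field; rewrite gt_eqF.
rewrite ler_peMr//; first by rewrite mulr_ge0 ?sqr_ge0// divr_ge0// ltW.
by rewrite ler_pdivlMr// mul1r; apply/lstar_le/iterates_feasible.
Qed.

Lemma l_descent_sum N :
  l N - l 0%N <= lam1 * (r N - r 0%N)
    + alpha / (4 * lstar) * \sum_(0 <= k < N) enorm (delta k) ^+ 2.
Proof.
elim: N => [|N IHN]; first by rewrite big_nil !subrr !mulr0 addr0.
by rewrite big_nat_recr//=; have := l_descent N; lra.
Qed.

(** * Positive lower bound for r *)

Section Stable.
Hypothesis eta_le_stab : eta <= eta_stab alpha lam1 lstar (l 0%N) (r 0%N).

(** [eta_stab] with denominators cleared: the largest total quadratic error fits into what remains
    of lam1 r_0 after l drops from l_0 to lstar. *)
Lemma eta_stab_ineq :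
  alpha / (4 * lstar) * (eta * r 0%N ^+ 2) <= lam1 * r 0%N - (l 0%N - lstar).
Proof.
have ls_gt0 := lstar_gt0.
have C_gt0 : 0 < alpha / (4 * lstar) * r 0%N ^+ 2.
  by rewrite mulr_gt0 ?exprn_gt0// divr_gt0// mulr_gt0.
rewrite mulrCA mulrC; move: eta_le_stab; rewrite -(ler_pM2l C_gt0) /eta_stab.
congr (_ <= _); field.
by rewrite !gt_eqF.
Qed.

(** The summed descent with l_N >= lstar and the exact value of the sum of squared steps;
    [eta_stab_ineq] cancels all the data at time 0. *)
Lemma r_lower_bound N :
  alpha / (4 * lstar) * eta * \sum_(0 <= k < N) (r k.+1 - r k) ^+ 2
    <= lam1 * r N.
Proof.
have ls_gt0 := lstar_gt0.
have := l_descent_sum N; rewrite sum_delta_sqr.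
have := lstar_le (iterates_feasible N); have := eta_stab_ineq.
have : 0 <= alpha / (4 * lstar) * eta * r N ^+ 2.
  rewrite mulr_ge0 ?sqr_ge0// mulr_ge0 ?(ltW eta_gt0)//.
  by rewrite divr_ge0 ?mulr_ge0// ltW.
move: (alpha / (4 * lstar)) => K; lra.
Qed.

(* For [eta = eta_stab] positivity comes from the term [(r 1 - r 0) ^+ 2]. *)
Lemma rlim_gt0 : 0 < limn r.
Proof.
have ls_gt0 := lstar_gt0.
have [v0|v0] := eqVneq (v 0%N) 0.
  (* A vanishing first step freezes the iteration, and r is constant. *)
  have stuck k : theta k = theta 0%N /\ r k = r 0%N.
    elim: k => [//|k [thetak rk]].
    have vk : v k = 0 by rewrite v_def thetak -v_def.
    by rewrite theta_step r_step vk scaler0 subr0 enorm0 expr0n mulr0 addr0 divr1.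
  have -> : r = fun=> r 0%N by apply/funext => k; have [] := stuck k.
  by rewrite lim_cst.
have K_gt0 : 0 < alpha / (4 * lstar) * eta.
  by rewrite mulr_gt0// divr_gt0// mulr_gt0.
pose d := alpha / (4 * lstar) * eta * (r 1%N - r 0%N) ^+ 2 / lam1.
have d_gt0 : 0 < d.
  rewrite divr_gt0// mulr_gt0// exprn_even_gt0//= subr_eq0 lt_eqF//.
  exact: r_step_lt.
apply: lt_le_trans d_gt0 _; apply: limr_ge; first exact: r_is_cvg.
near=> k; have k_gt0 : (0 < k)%N by near: k; exact: nbhs_infty_gt.
rewrite ler_pdivrMr// [leRHS]mulrC (le_trans _ (r_lower_bound k))// ler_pM2l//.
rewrite big_ltn// lerDl sumr_ge0// => j _; exact: sqr_ge0.
Unshelve. all: by end_near. Qed.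

End Stable.

(** * Monotone decrease of L *)

Section Monotone.
Hypothesis eta_le_zero : eta <= eta_zero alpha lam1 lstar (r 0%N).

(** [eta_zero] gives alpha eta r_{k+1} <= lam1 lstar, so the quadratic remainder is at most half of
    the first-order gain 4 eta r_{k+1} l_k q_k. *)
Lemma L_decrease k :
  L (theta k.+1) <= L (theta k) - 2 * eta * r k.+1 * (l k * q k).
Proof.
have Tk := iterates_feasible k.
have a_ge0 := ltW alpha_gt0; have e_ge0 := ltW eta_gt0.
have r_ge0 := ltW (r_gt0 k.+1); have l1_ge0 := ltW lam1_gt0.
have step_le : alpha * eta * r k.+1 <= lam1 * lstar.
  have : alpha * eta * r 0%N <= lam1 * lstar.
    move: eta_le_zero; rewrite /eta_zero ler_pdivlMr ?mulr_gt0//.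
    by rewrite mulrCA mulrA.
  by apply: le_trans; rewrite ler_wpM2l ?mulr_ge0 ?r_nonincreasing.
have lq : lam1 * lstar * enorm (v k) ^+ 2 <= l k * q k.
  rewrite mulrAC mulrC ler_pM ?mulr_ge0 ?sqr_ge0 ?enorm_ge0 ?(ltW lstar_gt0)//.
    exact: lstar_le.
  exact: G_ge.
have quad : alpha / 2 * enorm (delta k) ^+ 2 <= 2 * eta * r k.+1 * (l k * q k).
  apply: le_trans (_ : 2 * eta * r k.+1 * (lam1 * lstar * enorm (v k) ^+ 2) <= _).
    apply: le_trans (_ : 2 * eta * r k.+1 *
      (alpha * eta * r k.+1 * enorm (v k) ^+ 2) <= _).
      by rewrite enorm_delta le_eqVlt; apply/orP; left; apply/eqP; field.
    by rewrite ler_wpM2l ?mulr_ge0// ler_wpM2r ?sqr_ge0.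
  by rewrite ler_wpM2l// !mulr_ge0.
have := L_descent k; lra.
Qed.

Lemma L_step_le k : L (theta k.+1) <= L (theta k).
Proof.
apply: le_trans (L_decrease k) _; rewrite gerBl.
rewrite !mulr_ge0 ?(ltW eta_gt0) ?(ltW (r_gt0 _)) ?(ltW (l_gt0 _))//.
exact/G_ge0/iterates_feasible.
Qed.

Lemma L_nonincreasing : nonincreasing_seq (fun k => L (theta k)).
Proof. exact/nonincreasing_seqP/L_step_le. Qed.

Lemma L_is_cvg : cvgn (fun k => L (theta k)).
Proof.
apply: nonincreasing_is_cvgn L_nonincreasing _.
have [M ML] := L_bounded_below.
by exists M => _ [k _ <-]; apply: ML; exists (theta k).
Qed.

Lemma l_le k : l k <= l 0%N.
Proof.
rewrite ler_sqrt ?(ltW (L_shift_gt0 _))// lerD2r.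
exact: (L_nonincreasing (leq0n k)).
Qed.

(** In [Pgrad_sqr_le] one factor l_k matches the one in [L_decrease]; the other is bounded by l_0,
    as l decreases. *)
Lemma L_decrease_Pgrad k :
  L (theta k.+1) <= L (theta k)
    - eta * r k.+1 / (2 * l 0%N * lamn) * enorm (Pgrad (theta k)) ^+ 2.
Proof.
apply: le_trans (L_decrease k) _; rewrite lerD2l lerN2.
have l0_gt0 := l_gt0 (theta 0%N); have lk_gt0 := l_gt0 (theta k).
rewrite mulrAC ler_pdivrMr ?mulr_gt0//.
have c_ge0 : 0 <= eta * r k.+1 by rewrite mulr_ge0 ?(ltW (r_gt0 _))// ltW.
have c1_ge0 : 0 <= 4 * (eta * r k.+1) * l k * lamn * q k.
  by rewrite !mulr_ge0 ?(ltW eta_gt0) ?(ltW (r_gt0 _)) ?(ltW lk_gt0)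
    ?(ltW lamn_gt0)// G_ge0//; exact: iterates_feasible.
have := ler_wpM2l c_ge0 (Pgrad_sqr_le k); have := ler_wpM2l c1_ge0 (l_le k).
lra.
Qed.

End Monotone.

(** * Criticality of cluster points and convergence rates *)

Section Convergence.
Hypothesis eta_le_stab : eta <= eta_stab alpha lam1 lstar (l 0%N) (r 0%N).
Hypothesis eta_le_zero : eta <= eta_zero alpha lam1 lstar (r 0%N).

Let rlim_pos : 0 < limn r := rlim_gt0 eta_le_stab.

Lemma Pgrad_cvg0 : (fun k => enorm (Pgrad (theta k))) @ \oo --> 0.
Proof.
have l0_gt0 := l_gt0 (theta 0%N).
(* From |P^T grad L| <= 2 lamn l_0 |v_k| and |v_k| = |delta_k| / (2 eta r_{k+1}), with r_{k+1} at
   least its positive limit. *)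
pose C := lamn * l 0%N / (eta * limn r).
have Cdelta : (fun k => C * enorm (delta k)) @ \oo --> 0.
  rewrite -[X in _ --> X](mulr0 C); apply: cvgMl_tmp; exact: enorm_delta_cvg0.
apply: cvgr0_bound Cdelta => k; rewrite ger0_norm ?enorm_ge0//.
have C_ge0 : 0 <= 2 * lamn * l 0%N * enorm (v k).
  by rewrite !mulr_ge0 ?enorm_ge0 ?(ltW lamn_gt0) ?(ltW l0_gt0).
apply: (@le_trans _ _ (2 * lamn * l 0%N * enorm (v k))).
  rewrite -(ler_pXn2r (n := 2)) ?nnegrE ?enorm_ge0//.
  apply: le_trans (Pgrad_sqr_le_v k) _; rewrite -l_sqr.
  rewrite [leRHS](_ : _ = 4 * lamn ^+ 2 * l 0%N ^+ 2 * enorm (v k) ^+ 2);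
    last by ring.
  rewrite ler_wpM2r ?sqr_ge0// ler_wpM2l ?mulr_ge0 ?(ltW lamn_gt0)//.
  by rewrite lerXn2r ?nnegrE ?(ltW (l_gt0 _))// l_le.
rewrite enorm_delta /C.
rewrite [leRHS](_ : _ = 2 * lamn * l 0%N * enorm (v k) * (r k.+1 / limn r)).
  by rewrite ler_peMr// ler_pdivlMr// mul1r rlim_le.
by field; rewrite !gt_eqF.
Qed.

Lemma cluster_L x : cluster (theta @ \oo) x ->
  L x = limn (fun k => L (theta k)).
Proof.
move=> xcl; apply: (cluster_cvg_eq (g := L) _ (L_is_cvg eta_le_zero) xcl).
exact: differentiable_continuous (L_C1.1 x).
Qed.

(** Each coordinate of B x is a continuous functional that is constant along the iterates. *)
Lemma cluster_feasible x : cluster (theta @ \oo) x -> Theta x.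
Proof.
move=> xcl; apply/colP => i.
have coordE (y : 'cV[R]_n) : (B *m y) i 0 = dot y (row i B)^T.
  by rewrite dotE mxE; apply: eq_bigr => j _; rewrite !mxE mulrC.
rewrite coordE.
apply: (cluster_cvg_eq (g := fun y => dot y (row i B)^T) _ _ xcl).
  exact: dot_continuous.
have thetab : (fun k => dot (theta k) (row i B)^T) = fun=> b i 0.
  by apply/funext => k; rewrite -coordE iterates_feasible.
have : (fun k => dot (theta k) (row i B)^T) @ \oo --> b i 0.
  by rewrite thetab; exact: cvg_cst.
exact.
Qed.

(* [P] need not be continuous, so the limit is taken in [dot (grad L _) y] for *)
(* each fixed [y] in the kernel of [B].                                       *)
Lemma cluster_Pgrad x : cluster (theta @ \oo) x -> Pgrad x = 0.
Proof.
move=> xcl; have Tx := cluster_feasible xcl.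
have grad_ker y : B *m y = 0 -> dot (grad L x) y = 0.
  move=> By; apply: (cluster_cvg_eq (g := fun z => dot (grad L z) y) _ _ xcl).
    apply: (@continuous_comp _ _ _ (grad L) (fun z => dot z y)).
      exact: L_C1.2.
    exact: dot_continuous.
  have bound : (fun k => enorm (Pgrad (theta k)) * enorm y) @ \oo --> 0.
    rewrite -[X in _ --> X](mul0r (enorm y)); apply: cvgMr_tmp; exact: Pgrad_cvg0.
  apply: cvgr0_bound bound => k /=.
  rewrite -Pgrad_dot//; first exact: normr_dot_le.
  exact: iterates_feasible.
(* Transposition moves P onto z, and P z lies in the kernel of B. *)
apply: dot_inj => z; rewrite dot_trmx grad_ker; first by rewrite /dot inner0l.
by have [BP _] := P_proj Tx; exact: BP.
Qed.

Section Minimizer.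
Variable thetastar : 'cV[R]_n.
Hypothesis thetastar_min : minimizer_on Theta L thetastar.

Local Notation w k := (L (theta k) - L thetastar).

Lemma gap_ge0 k : 0 <= w k.
Proof. by rewrite subr_ge0; apply: thetastar_min.2; exact: iterates_feasible. Qed.

(** * Linear rate and finite length under the PL condition *)

Section PolyakLojasiewicz.
Variable mu : R.
Hypothesis mu_gt0 : 0 < mu.
Hypothesis PL : forall x, Theta x ->
  mu * (L x - L thetastar) <= 2^-1 * enorm (Pgrad x) ^+ 2.

Local Notation c0 := (mu * eta / l 0%N).

Lemma PL_contraction k : w k.+1 <= (1 - c0 * r k.+1 / lamn) * w k.
Proof.
have l0_gt0 := l_gt0 (theta 0%N).
have C_ge0 : 0 <= eta * r k.+1 / (l 0%N * lamn).
  rewrite divr_ge0// mulr_ge0 ?(ltW (r_gt0 _)) ?(ltW lamn_gt0) ?(ltW l0_gt0)//.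
  exact: ltW.
have := ler_wpM2l C_ge0 (PL (iterates_feasible k)).
have := L_decrease_Pgrad eta_le_zero k.
rewrite (_ : eta * r k.+1 / (2 * l 0%N * lamn) * _ =
  eta * r k.+1 / (l 0%N * lamn) * (2^-1 * enorm (Pgrad (theta k)) ^+ 2));
  last first.
  by field; rewrite !gt_eqF.
rewrite (_ : (1 - c0 * r k.+1 / lamn) * w k =
  w k - eta * r k.+1 / (l 0%N * lamn) * (mu * w k)); last first.
  by field; rewrite !gt_eqF.
lra.
Qed.

Lemma PL_rate k : w k <= expR (- (c0 * k%:R * r k / lamn)) * w 0%N.
Proof.
have l0_gt0 := l_gt0 (theta 0%N).
(* The final index k is frozen while j runs up to it: r_{j+1} >= r_k gives all the contraction
   factors one common bound. *)
have rate j : (j <= k)%N -> w j <= expR (j%:R * - (c0 * r k / lamn)) * w 0%N.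
  elim: j => [_|j IHj jk]; first by rewrite mul0r expR0 mul1r.
  apply: le_trans (PL_contraction j) _.
  apply: (@le_trans _ _ (expR (- (c0 * r k / lamn)) * w j)).
    rewrite ler_wpM2r ?gap_ge0// (le_trans _ (expR_ge1Dx _))// lerD2l lerN2.
    rewrite ler_wpM2r ?invr_ge0 ?(ltW lamn_gt0)// ler_wpM2l ?r_nonincreasing//.
    by rewrite divr_ge0 ?mulr_ge0// ltW.
  rewrite -natr1 mulrDl mul1r expRD [expR _ * expR _]mulrC -[leRHS]mulrA.
  by rewrite ler_wpM2l ?expR_ge0// IHj// ltnW.
have := rate k (leqnn k); congr (_ <= expR _ * _).
by ring.
Qed.

(** The decrease of L in one step cannot exceed the gap, and it controls |v_k|^2; so step lengths
    inherit the decay of the gap. *)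
Lemma delta_sqr_le_gap k :
  enorm (delta k) ^+ 2 <= 2 * eta * r 0%N / (lam1 * lstar) * w k.
Proof.
have Tk := iterates_feasible k; have ls_gt0 := lstar_gt0.
have a_ge0 : 0 <= 2 * eta * r k.+1.
  by rewrite !mulr_ge0 ?(ltW (r_gt0 _))// ltW.
rewrite mulrAC ler_pdivlMr ?mulr_gt0//.
apply: (@le_trans _ _ (2 * eta * r k.+1 * w k)); last first.
  rewrite ler_wpM2r ?gap_ge0// ler_wpM2l ?r_nonincreasing// mulr_ge0//.
  exact: ltW.
have -> : enorm (delta k) ^+ 2 * (lam1 * lstar) =
    2 * eta * r k.+1 * (2 * eta * r k.+1 * (lstar * (lam1 * enorm (v k) ^+ 2))).
  by rewrite enorm_delta; ring.
rewrite ler_wpM2l//; have := L_decrease eta_le_zero k; have := gap_ge0 k.+1.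
have : lstar * (lam1 * enorm (v k) ^+ 2) <= l k * q k.
  rewrite ler_pM ?mulr_ge0 ?sqr_ge0 ?enorm_ge0 ?(ltW ls_gt0) ?(ltW lam1_gt0)//.
    exact: lstar_le.
  exact: G_ge.
move/(ler_wpM2l a_ge0); lra.
Qed.

Lemma PL_finite_length : exists M : R,
  forall N, \sum_(0 <= k < N) enorm (delta k) <= M.
Proof.
have l0_gt0 := l_gt0 (theta 0%N); have ls_gt0 := lstar_gt0.
(* The limit of r makes the exponent uniform in k; the half comes from taking the square root in
   [delta_sqr_le_gap]. *)
pose s := c0 * limn r / lamn / 2.
have s_gt0 : 0 < s by rewrite !divr_gt0// mulr_gt0// divr_gt0// mulr_gt0.
pose C := 2 * eta * r 0%N / (lam1 * lstar).
have C_ge0 : 0 <= C.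
  by rewrite divr_ge0 ?mulr_ge0// ltW.
have geom k : enorm (delta k) <= Num.sqrt (C * w 0%N) * expR (- s) ^+ k.
  rewrite -(ler_pXn2r (n := 2)) ?nnegrE ?enorm_ge0 ?mulr_ge0 ?sqrtr_ge0
    ?exprn_ge0 ?expR_ge0//.
  rewrite exprMn [in leRHS]sqr_sqrtr ?(mulr_ge0 C_ge0) ?gap_ge0//.
  apply: le_trans (delta_sqr_le_gap k) _; rewrite -/C -[leRHS]mulrA ler_wpM2l//.
  apply: le_trans (PL_rate k) _; rewrite mulrC ler_wpM2l ?gap_ge0//.
  rewrite -!expRM_natl ler_expR mulrA mulrN lerN2.
  rewrite (_ : 2%:R * k%:R * s = c0 * k%:R * limn r / lamn); last first.
    by rewrite /s; field; rewrite !gt_eqF.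
  rewrite ler_wpM2r ?invr_ge0 ?(ltW lamn_gt0)// ler_wpM2l ?rlim_le//.
  by rewrite mulr_ge0// divr_ge0 ?mulr_ge0// ltW.
exists (Num.sqrt (C * w 0%N) * (1 - expR (- s))^-1); move=> N.
apply: le_trans (ler_sum _ (fun k _ => geom k)) _.
rewrite -mulr_sumr ler_wpM2l ?sqrtr_ge0// geometric_sum_le ?expR_ge0//.
by rewrite -expR0 ltr_expR oppr_lt0.
Qed.

End PolyakLojasiewicz.

(** * Sublinear rates for convex L *)

Section Convex.
Hypothesis L_convex : convex_function [set: convex_lmodType 'cV[R]_n] L.

(** The first-order convexity inequality; the difference of two feasible points lies in ker B, so
    inserting the projection changes nothing. *)
Lemma gap_le_dot k : w k <= dot (Pgrad (theta k)) (theta k - thetastar).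
Proof.
have Tk := iterates_feasible k.
rewrite Pgrad_dot//; last first.
  by rewrite mulmxBr Tk thetastar_min.1 subrr.
have := convex_gradient thetastar (L_C1.1 (theta k)) L_convex.
rewrite -(opprB (theta k)) /dot innerNr; lra.
Qed.

(** An instance of [sublinear_rate]: [D] bounds the distances of the first k iterates to the
    minimizer, and since r_{j+1} >= r_k the coefficient [a] serves for all j < k. *)
Lemma convex_rate k : (1 <= k)%N ->
  w k <= 2 * l 0%N / eta * lamn
    * (\big[Num.max/enorm (theta 0%N - thetastar)]_(j < k)
         enorm (theta j - thetastar)) ^+ 2 / (k%:R * r k).
Proof.
move=> k_gt0; have l0_gt0 := l_gt0 (theta 0%N); set D := \big[_/_]_(_ < _) _.
have D_ge0 : 0 <= D by apply: le_trans (bigmax_ge_id _ _ _ _); exact: enorm_ge0.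
have D_ge j : (j < k)%N -> enorm (theta j - thetastar) <= D.
  by move=> jk; exact: (le_bigmax _ _ (Ordinal jk)).
pose a := eta * r k / (2 * l 0%N * lamn).
have a_gt0 : 0 < a by rewrite divr_gt0 ?mulr_gt0 ?r_gt0.
have := @sublinear_rate _ (fun j => w j)
  (fun j => enorm (Pgrad (theta j))) a D k a_gt0 D_ge0 gap_ge0.
have kr_gt0 : 0 < k%:R * r k by rewrite mulr_gt0 ?r_gt0// ltr0n.
rewrite ler_pdivlMr// => rate.
rewrite mulrAC -[_ * lamn]mulrA -mulrA.
rewrite [leRHS](_ : _ = (2 * l 0%N * lamn / eta) * D ^+ 2); last by ring.
rewrite (_ : w k * (k%:R * r k) = 
  (2 * l 0%N * lamn / eta) * (k%:R * a * w k)); last first.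
  by rewrite /a; field; rewrite !gt_eqF.
rewrite ler_wpM2l//.
  by rewrite divr_ge0 ?mulr_ge0 ?(ltW l0_gt0) ?(ltW lamn_gt0)// ltW.
apply: rate => j jk.
  apply: le_trans (gap_le_dot j) _; apply: le_trans (dot_le_enorm _ _) _.
  by rewrite mulrC ler_wpM2r ?enorm_ge0// D_ge.
rewrite lerBlDr addrAC subrK (le_trans (L_decrease_Pgrad eta_le_zero j))//.
rewrite lerD2l lerN2 ler_wpM2r ?sqr_ge0// ler_wpM2r ?invr_ge0 ?mulr_ge0
  ?(ltW l0_gt0) ?(ltW lamn_gt0)//.
by rewrite ler_wpM2l ?r_nonincreasing// ltW.
Qed.

(* With a fixed metric the [G]-distance to the minimizer telescopes. *)
Lemma convex_rate_const_metric k :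
  (forall x y, Theta x -> Theta y -> G x = G y) -> (1 <= k)%N ->
  w k <= 2 * l 0%N / eta * lamn * enorm (theta 0%N - thetastar) ^+ 2
           / (k%:R * r k).
Proof.
move=> G_const k_gt0; have l0_gt0 := l_gt0 (theta 0%N).
pose H := G (theta 0%N).
have GH j : G (theta j) = H by apply: G_const; exact: iterates_feasible.
have symH : H^T = H by apply: G_sym.
pose d j := inner H (theta j - thetastar) (theta j - thetastar).
have d_ge0 j : 0 <= d j by exact: G_ge0.
(* In the expansion of d_j - d_{j+1}, convexity bounds the cross term below by the gap at j, and
   [L_decrease] absorbs the square term by passing to the gap at j + 1. *)
have step j : 2 * eta * r j.+1 / l j * w j.+1 <= d j - d j.+1.
  have lj_gt0 := l_gt0 (theta j).
  set x := theta j - thetastar; set t := 2 * eta * r j.+1.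
  have t_ge0 : 0 <= t by rewrite !mulr_ge0 ?(ltW (r_gt0 _))// ltW.
  have -> : d j - d j.+1 = 2 * t * inner H (v j) x - t ^+ 2 * inner H (v j) (v j).
    have expand (y z : 'cV[R]_n) (a : R) : inner H y y -
        inner H (y - a *: z) (y - a *: z) =
        2 * a * inner H z y - a ^+ 2 * inner H z z.
      rewrite innerDl !innerDr !innerNl !innerNr !innerZl !innerZr (innerC y)//.
      by ring.
    rewrite /d; have -> : theta j.+1 - thetastar = x - t *: v j.
      by rewrite theta_step addrAC.
    exact: expand.
  have gap : w j <= 2 * l j * inner H (v j) x.
    apply: le_trans (gap_le_dot j) _.
    by rewrite Pgrad_Gv GH dotC /dot innerZr -/(dot _ _) -inner_dot (innerC x).
  have dec := L_decrease eta_le_zero j; rewrite GH -/t in dec.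
  rewrite mulrAC ler_pdivrMr//.
  have := ler_wpM2l t_ge0 gap; have := ler_wpM2l t_ge0 dec; lra.
(* Every summand dominates the same quantity, as r_{j+1} >= r_k, l_j <= l_0 and w_{j+1} >= w_k. *)
have sum_le : \sum_(0 <= j < k) 2 * eta * r k / l 0%N * w k <=
    \sum_(0 <= j < k) (d j - d j.+1).
  apply: ler_sum_nat => j /andP[_ jk]; apply: le_trans (step j).
  rewrite ler_pM ?gap_ge0 ?divr_ge0 ?mulr_ge0 ?(ltW (r_gt0 _)) ?(ltW (l_gt0 _))//.
  - exact: ltW.
  - rewrite ler_pM ?invr_ge0 ?mulr_ge0 ?(ltW (r_gt0 _)) ?(ltW (l_gt0 _))
      ?(ltW eta_gt0)//.
      by rewrite ler_wpM2l ?r_nonincreasing// mulr_ge0// ltW.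
    by rewrite lef_pV2 ?posrE ?l_gt0// l_le.
  - by rewrite lerD2r; exact: (L_nonincreasing eta_le_zero).
move: sum_le; rewrite sumr_const_nat subn0.
rewrite (telescope_sumr_eq (fun j => - d j)) => [|//|j _]; last first.
  by rewrite opprK addrC.
rewrite opprK [- d k + _]addrC => sum_le.
have d0_le : d 0%N <= lamn * enorm (theta 0%N - thetastar) ^+ 2 by exact: G_le.
have kr_gt0 : 0 < k%:R * r k by rewrite mulr_gt0 ?r_gt0// ltr0n.
rewrite ler_pdivlMr//.
have S_ge0 : 0 <= lamn * enorm (theta 0%N - thetastar) ^+ 2.
  exact: le_trans d0_le.
have main : 2 * eta * (r k * w k * k%:R) <=
    l 0%N * (lamn * enorm (theta 0%N - thetastar) ^+ 2).
  have := le_trans sum_le (_ : d 0%N - d k <=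
    lamn * enorm (theta 0%N - thetastar) ^+ 2).
  rewrite lerBlDr ler_wpDr// => /(_ isT); rewrite -(ler_pM2l l0_gt0).
  apply: le_trans; rewrite -mulr_natr le_eqVlt; apply/orP; left; apply/eqP.
  by field; rewrite gt_eqF.
rewrite -(ler_pM2l eta_gt0).
rewrite [leRHS](_ : _ = 2 * (l 0%N * (lamn * enorm (theta 0%N - thetastar) ^+ 2))).
  by have := mulr_ge0 (ltW l0_gt0) S_ge0; lra.
by field; rewrite gt_eqF.
Qed.

End Convex.
End Minimizer.
End Convergence.

End Smooth.
End Iteration.

(** Strict decrease of r is stated where v_k is nonzero, since a zero step freezes the iteration.
    The limit of L is related to local minima through cluster points of the iterates: these are
    feasible and critical, hence local minimizers as soon as every feasible critical point is
    one. *)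
Theorem theorem2p10 (R : realType) (m n : nat)
  (L : 'cV[R]_n -> R) (c : R)
  (B : 'M[R]_(m, n)) (b : 'cV[R]_m)
  (G P : 'cV[R]_n -> 'M[R]_n) (lam1 lamn : R)
  (eta : R) (theta v : nat -> 'cV[R]_n) (r : nat -> R)
  (L_C1 : class_C1 L)
  (L_bounded_below : has_lbound (range L))
  (Lc_gt0 : 0 < inf (range (fun x => L x + c)))
  (lam1_gt0 : 0 < lam1) (lam1_le_lamn : lam1 <= lamn)
  (G_spd : forall x, affine_set B b x -> sym_posdef (G x))
  (G_spectrum : forall x, affine_set B b x ->
    forall a : R, eigenvalue (G x) a -> lam1 <= a /\ a <= lamn)
  (P_proj : forall x, affine_set B b x -> orth_proj_ker (G x) B (P x))
  (theta0 : affine_set B b (theta 0%N)) (r0_gt0 : 0 < r 0%N) (eta_gt0 : 0 < eta)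
  (v_def : forall k, v k =
    P (theta k) *m invmx (G (theta k)) *m grad (sqrt_shift L c) (theta k))
  (r_step : forall k, r k.+1 = r k / (1 + 2 * eta * enorm (v k) ^+ 2))
  (theta_step : forall k, theta k.+1 = theta k - (2 * eta * r k.+1) *: v k) :
  let Theta := affine_set B b in
  let l := sqrt_shift L c in
  let lstar := sqrt_shift_inf L c Theta in
  let rstar := limn r in
  let Pgrad := fun x => (P x)^T *m grad L x in
  (* (1) *)
  [/\ (forall k, r k.+1 ^+ 2 = r k ^+ 2 - (r k.+1 - r k) ^+ 2
         - eta^-1 * enorm (theta k.+1 - theta k) ^+ 2),
      (forall k, r k.+1 <= r k /\ (v k != 0 -> r k.+1 < r k)),
      r @ \oo --> rstar,
      (\sum_(0 <= k <oo) (enorm (theta k.+1 - theta k) ^+ 2)%:E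
         <= (eta * r 0%N ^+ 2)%:E)%E
    & (fun k => enorm (theta k.+1 - theta k)) @ \oo --> 0]
  /\
  (* (2) *)
  (forall alpha : R, 0 < alpha -> smooth alpha L ->
     (l (theta 0%N) - lstar) / lam1 <= r 0%N ->
     eta < eta_stab alpha lam1 lstar (l (theta 0%N)) (r 0%N) ->
     0 < rstar /\ (forall k, rstar <= r k))
  /\
  (* (3) *)
  (forall alpha : R, 0 < alpha -> smooth alpha L ->
     (l (theta 0%N) - lstar) / lam1 <= r 0%N ->
     eta <= Num.min (eta_zero alpha lam1 lstar (r 0%N))
                    (eta_stab alpha lam1 lstar (l (theta 0%N)) (r 0%N)) ->
     [/\ (forall k, L (theta k.+1) <= L (theta k)),
         (fun k => L (theta k)) @ \oo --> limn (fun k => L (theta k)),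
         (forall x, cluster (theta @ \oo) x ->
            [/\ Theta x, Pgrad x = 0 & L x = limn (fun k => L (theta k))]),
         (cluster (theta @ \oo) !=set0 ->
          (forall x, Theta x -> Pgrad x = 0 -> local_minimizer_on Theta L x) ->
          exists2 x, local_minimizer_on Theta L x
                   & L x = limn (fun k => L (theta k)))
       & (fun k => enorm (Pgrad (theta k))) @ \oo --> 0])
  /\
  (* (4)(i) *)
  (forall k, (1 <= k)%N ->
     \big[Num.min/enorm (Pgrad (theta 0%N)) ^+ 2]_(j < k)
        (enorm (Pgrad (theta j)) ^+ 2)
     <= 2 * r 0%N * lamn ^+ 2 / (eta * r k * k%:R)
        * (\big[Num.max/L (theta 0%N)]_(j < k) L (theta j) + c))
  /\
  (* (4)(ii), (4)(iii) *)
  (forall alpha : R, 0 < alpha -> smooth alpha L ->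
     (l (theta 0%N) - lstar) / lam1 <= r 0%N ->
     eta <= Num.min (eta_zero alpha lam1 lstar (r 0%N))
                    (eta_stab alpha lam1 lstar (l (theta 0%N)) (r 0%N)) ->
     [/\ 0 < rstar,
         (forall k, rstar <= r k /\ (v k != 0 -> rstar < r k)),
         (forall (thetastar : 'cV[R]_n) (mu : R),
            minimizer_on Theta L thetastar -> 0 < mu ->
            (forall x, Theta x ->
               mu * (L x - L thetastar) <= 2^-1 * enorm (Pgrad x) ^+ 2) ->
            let c0 := mu * eta / l (theta 0%N) in
            [/\ (\sum_(0 <= k <oo) (enorm (theta k.+1 - theta k))%:E < +oo)%E,
                cvgn theta
              & forall k, L (theta k) - L thetastar
                  <= expR (- (c0 * k%:R * r k / lamn))
                     * (L (theta 0%N) - L thetastar)])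
       & (forall thetastar : 'cV[R]_n,
            minimizer_on Theta L thetastar ->
            convex_function [set: convex_lmodType 'cV[R]_n] L ->
            let c1 := 2 * l (theta 0%N) / eta in
            forall k, (1 <= k)%N ->
              L (theta k) - L thetastar
                <= c1 * lamn
                   * (\big[Num.max/enorm (theta 0%N - thetastar)]_(j < k)
                        enorm (theta j - thetastar)) ^+ 2 / (k%:R * r k)
              /\
              ((forall x y, Theta x -> Theta y -> G x = G y) ->
               L (theta k) - L thetastar
                 <= c1 * lamn * enorm (theta 0%N - thetastar) ^+ 2
                    / (k%:R * r k)))]).
Proof.
move=> Theta l lstar rstar Pgrad.
split; [|split; [|split; [|split]]].
- split.
  + by move=> k; apply: energy_identity.
  + move=> k; split; first by apply: r_step_le r0_gt0 eta_gt0 r_step k.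
    by apply: r_step_lt r0_gt0 eta_gt0 r_step k.
  + exact: r_is_cvg r0_gt0 eta_gt0 r_step.
  + apply: nneseries_le_bound => [k|N]; first exact: sqr_ge0.
    exact: sum_delta_sqr_le r0_gt0 eta_gt0 r_step theta_step N.
  + exact: enorm_delta_cvg0 r0_gt0 eta_gt0 r_step theta_step.
- move=> alpha alpha_gt0 smoothL _ /ltW eta_stable; split.
    exact: (rlim_gt0 L_C1 L_bounded_below Lc_gt0 lam1_gt0 G_spd G_spectrum
        P_proj theta0 r0_gt0 eta_gt0 v_def r_step theta_step alpha_gt0
        smoothL eta_stable).
  exact: rlim_le r0_gt0 eta_gt0 r_step.
- move=> alpha alpha_gt0 smoothL _; rewrite le_min => /andP[eta_zero eta_stable].
  have Lcvg : cvgn (fun k => L (theta k)).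
    exact: (L_is_cvg L_C1 L_bounded_below Lc_gt0 lam1_gt0 G_spd G_spectrum
        P_proj theta0 r0_gt0 eta_gt0 v_def r_step theta_step alpha_gt0
        smoothL eta_zero).
  have feasible x : cluster (theta @ \oo) x -> Theta x.
    move=> xcl; exact: (cluster_feasible P_proj theta0 v_def theta_step xcl).
  have critical x : cluster (theta @ \oo) x -> Pgrad x = 0.
    move=> xcl; exact: (cluster_Pgrad L_C1 L_bounded_below Lc_gt0 lam1_gt0
        lam1_le_lamn G_spd G_spectrum P_proj theta0 r0_gt0 eta_gt0 v_def
        r_step theta_step alpha_gt0 smoothL eta_stable eta_zero xcl).
  have value x : cluster (theta @ \oo) x -> L x = limn (fun k => L (theta k)).
    move=> xcl; exact: (cluster_L L_C1 L_bounded_below Lc_gt0 lam1_gt0 G_spd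
        G_spectrum P_proj theta0 r0_gt0 eta_gt0 v_def r_step theta_step
        alpha_gt0 smoothL eta_zero xcl).
  split=> //.
  + move=> k; exact: (L_step_le L_C1 L_bounded_below Lc_gt0 lam1_gt0 G_spd
      G_spectrum P_proj theta0 r0_gt0 eta_gt0 v_def r_step theta_step
      alpha_gt0 smoothL eta_zero k).
  + by move=> x xcl; split; [exact: feasible|exact: critical|exact: value].
  + move=> [x xcl] crit_min; exists x; last exact: value.
    by apply: crit_min; [exact: feasible|exact: critical].
  + exact: (Pgrad_cvg0 L_C1 L_bounded_below Lc_gt0 lam1_gt0 lam1_le_lamn
      G_spd G_spectrum P_proj theta0 r0_gt0 eta_gt0 v_def r_step theta_step
      alpha_gt0 smoothL eta_stable eta_zero).
- move=> k k_gt0; exact: (min_Pgrad_rate L_C1 L_bounded_below Lc_gt0 lam1_gt0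
      lam1_le_lamn G_spd G_spectrum P_proj theta0 r0_gt0 eta_gt0 v_def r_step theta_step k_gt0).
- move=> alpha alpha_gt0 smoothL _; rewrite le_min => /andP[eta_zero eta_stable].
  split.
  + exact: (rlim_gt0 L_C1 L_bounded_below Lc_gt0 lam1_gt0 G_spd G_spectrum
      P_proj theta0 r0_gt0 eta_gt0 v_def r_step theta_step alpha_gt0 smoothL
      eta_stable).
  + move=> k; split; first exact: rlim_le r0_gt0 eta_gt0 r_step k.
    move=> vk; apply: le_lt_trans (_ : r k.+1 < r k).
      exact: rlim_le r0_gt0 eta_gt0 r_step k.+1.
    exact: r_step_lt r0_gt0 eta_gt0 r_step k vk.
  + move=> thetastar mu thetastar_min mu_gt0 PL c0.
    have [M sumM] : exists M : R,
        forall N, \sum_(0 <= k < N) enorm (theta k.+1 - theta k) <= M.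
      exact: (PL_finite_length L_C1 L_bounded_below Lc_gt0 lam1_gt0
          lam1_le_lamn G_spd G_spectrum P_proj theta0 r0_gt0 eta_gt0 v_def
          r_step theta_step alpha_gt0 smoothL eta_stable eta_zero
          thetastar_min mu_gt0 PL).
    split.
    * apply: le_lt_trans (ltry M); apply: nneseries_le_bound => // k.
      exact: enorm_ge0.
    * exact: cvg_of_summable_steps sumM.
    * move=> k; exact: (PL_rate L_C1 L_bounded_below Lc_gt0 lam1_gt0
        lam1_le_lamn G_spd G_spectrum P_proj theta0 r0_gt0 eta_gt0 v_def
        r_step theta_step alpha_gt0 smoothL eta_zero thetastar_min mu_gt0 PL
        k).
  + move=> thetastar thetastar_min L_convex c1 k k_gt0; split.
      exact: (convex_rate L_C1 L_bounded_below Lc_gt0 lam1_gt0 lam1_le_lamn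
          G_spd G_spectrum P_proj theta0 r0_gt0 eta_gt0 v_def r_step
          theta_step alpha_gt0 smoothL eta_zero thetastar_min L_convex k_gt0).
    move=> G_const; exact: (convex_rate_const_metric L_C1 L_bounded_below
        Lc_gt0 lam1_gt0 G_spd G_spectrum P_proj theta0 r0_gt0 eta_gt0 v_def
        r_step theta_step alpha_gt0 smoothL eta_zero thetastar_min L_convex
        G_const k_gt0).
Qed.
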